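(* Let $(R,\mathfrak m)$ be a complete (Noetherian) local ring of mixed characteristic with residue field of characteristic $p>0$, and write $R\cong Q/I$, where $Q=V[[x_2,\dots,x_n]]$, $(V,pV)$ is an unramified complete discrete valuation ring of mixed characteristic $(0,p)$ and $I\subseteq Q$ is an ideal. Let $G=\bigoplus_{i\ge0}\mathfrak m^i/\mathfrak m^{i+1}$ and let $\widehat G$ be its completion at $G_+=\bigoplus_{i>0}\mathfrak m^i/\mathfrak m^{i+1}$. Let $S=Q[[x_1]]\cong V[[x_1,\dots,x_n]]$, $T=S[[t]]$, let $\pi:S\to Q$ be the surjective map of complete $Q$-algebras with $x_1\mapsto p$, and let $\overline{\hom}(I)=\hom(\pi^{-1}(I))\subseteq T$. Set $\hom(R):=T/\overline{\hom}(I)$. Then $t$ is a non-zero divisor on $\hom(R)$, and $\hom(R)/(t)\cong\widehat G$. Moreover, $$\big(\hom(R)\otimes_{V[[t]]}V((t))\big)^{\wedge}\cong\big(R\otimes_V V((t))\big)^{\wedge},$$ where on the left-hand side the completion is taken with respect to the extension of $(p,x_1,\dots,x_n)$, and on the right-hand side with respect to the extension of $\mathfrak m=(p,x_2,\dots,x_n)$.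
   Context: Mixed characteristic means that $R$ does not contain a field: its characteristic is $0$ or $p^m$ with $m>1$, and its residue field has characteristic $p$. An unramified complete discrete valuation ring of mixed characteristic $(0,p)$ is a complete discrete valuation ring of characteristic $0$ with maximal ideal generated by $p$. Homogenization: for $0\neq f\in S=V[[x_1,\dots,x_n]]$ let $o(f)=\max\{i\mid f\in(x_1,\dots,x_n)^i\}$ (elements of $V$ have degree $0$), let $\psi:S\to T=S[[t]]$ be the homomorphism of $V$-algebras substituting $x_i\mapsto x_it$, and set $\hom(f)=t^{-o(f)}\psi(f)\in T$. For an ideal $L\subseteq S$, $\hom(L)=(\hom(f)\mid0\neq f\in L)\subseteq T$. $V((t))=V[[t]][t^{-1}]$. *)

(* Defs.v *)
(* MathComp with the classical axioms of boolp *)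
From HB Require Import structures.
From mathcomp Require Import all_boot all_order all_algebra.
From mathcomp Require Import generic_quotient zify.
From mathcomp Require Import boolp classical_sets.

Set Implicit Arguments.
Unset Strict Implicit.
Unset Printing Implicit Defensive.
Import GRing.Theory.
Local Open Scope quotient_scope.
Local Open Scope ring_scope.
Local Open Scope classical_set_scope.

(*  Ideals need not be proper, unlike those of ring_quotient: a quotient may  *)
(*  be the zero ring, whence comPzRingType.                                   *)

Definition is_ideal (A : comPzRingType) (I : set A) : Prop :=
  [/\ I 0, forall x y, I x -> I y -> I (x + y) & forall a x, I x -> I (a * x)].

Record ideal (A : comPzRingType) := Ideal {
  ideal_set :> A -> Prop;
  idealP : is_ideal ideal_set }.

Section IdealOps.
Variable A : comPzRingType.
Implicit Types (X Y : set A) (I : ideal A).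

Lemma ideal0 I : I 0. Proof. by case: (idealP I). Qed.
Lemma idealD I x y : I x -> I y -> I (x + y).
Proof. by case: (idealP I) => _ + _; apply. Qed.
Lemma idealM I a x : I x -> I (a * x).
Proof. by case: (idealP I) => _ _; apply. Qed.
Lemma idealN I x : I x -> I (- x).
Proof. by move=> Ix; rewrite -mulN1r; apply: idealM. Qed.
Lemma idealB I x y : I x -> I y -> I (x - y).
Proof. by move=> Ix Iy; apply/idealD/idealN. Qed.

Lemma smallest_is_ideal X : is_ideal (smallest (@is_ideal A) X).
Proof.
split.
- by move=> J [[]].
- by move=> x y hx hy J JP; case: (JP) => -[_ + _] _; apply; [apply: hx|apply: hy].
- by move=> a x hx J JP; case: (JP) => -[_ _ +] _; apply; apply: hx.
Qed.

Definition igen X : ideal A := Ideal (smallest_is_ideal X).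

Lemma igen_sub X x : X x -> igen X x.
Proof. by move=> Xx J [_]; apply. Qed.

Lemma igen_min X I : (forall x, X x -> I x) -> forall x, igen X x -> I x.
Proof. by move=> XI x; apply; split; [apply: idealP|]. Qed.

Definition imul X Y : ideal A := igen [set a * b | a in X & b in Y].

Lemma setT_is_ideal : is_ideal [set: A].
Proof. by []. Qed.

Fixpoint iexp X (k : nat) : ideal A :=
  if k is l.+1 then imul X (iexp X l) else Ideal setT_is_ideal.

Lemma iexpM X i j a b : iexp X i a -> iexp X j b -> iexp X (i + j) (a * b).
Proof.
elim: i a => [|i IH] a ha hb /=; first exact: idealM.
have Pideal : is_ideal [set a | imul X (iexp X (i + j)) (a * b)].
  rewrite /mkset; split; first by rewrite mul0r; apply: ideal0.
  - by move=> x y hx hy; rewrite mulrDl; apply: idealD.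
  - by move=> c x hx; rewrite -mulrA; apply: idealM.
apply: (@igen_min _ (Ideal Pideal) _ a ha) => x [y Xy [z hz <-]] /=.
by rewrite -mulrA; apply: igen_sub; exists y => //; exists (z * b) => //; apply: IH.
Qed.

Lemma iexpW X k a : iexp X k.+1 a -> iexp X k a.
Proof.
by apply: igen_min => x [y _ [z hz <-]]; apply: idealM.
Qed.

End IdealOps.

Lemma preimage_is_ideal (A B : comPzRingType) (f : {rmorphism A -> B})
  (I : ideal B) : is_ideal (f @^-1` I).
Proof.
split=> /=; first by rewrite rmorph0; apply: ideal0.
- by move=> x y hx hy; rewrite rmorphD; apply: idealD.
- by move=> a x hx; rewrite rmorphM; apply: idealM.
Qed.

Definition ipreim (A B : comPzRingType) (f : {rmorphism A -> B}) (I : ideal B) :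
  ideal A := Ideal (preimage_is_ideal f I).

Section Quotient.
Variables (A : comPzRingType) (I : ideal A).

Definition idrel : rel A := fun x y => `[< I (x - y) >].

Lemma idrelP x y : reflect (I (x - y)) (idrel x y).
Proof. exact: asboolP. Qed.

Fact idrel_equiv : equiv_class_of idrel.
Proof.
split=> [x|x y|y x z].
- by apply/idrelP; rewrite subrr; apply: ideal0.
- by apply/idrelP/idrelP => /idealN; rewrite opprB.
- by move=> /idrelP h1 /idrelP h2; apply/idrelP; rewrite -(subrKA y); apply: idealD.
Qed.
Canonical idrel_equivRel := EquivRelPack idrel_equiv.

Definition quot := {eq_quot idrel}.
HB.instance Definition _ := Choice.on quot.
HB.instance Definition _ := EqQuotient.on quot.

Definition qpi (x : A) : quot := \pi_quot x.

Lemma qpi_eq x y : qpi x = qpi y <-> I (x - y).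
Proof.
by split=> [/eqP|h]; [rewrite /qpi eqmodE => /idrelP
                    | apply/eqP; rewrite /qpi eqmodE; apply/idrelP].
Qed.

Lemma qpi_surj (u : quot) : exists x, u = qpi x.
Proof. by exists (repr u); rewrite /qpi reprK. Qed.

Definition qadd (u v : quot) : quot := qpi (repr u + repr v).
Definition qopp (u : quot) : quot := qpi (- repr u).
Definition qmul (u v : quot) : quot := qpi (repr u * repr v).

Lemma repr_qpi x : I (repr (qpi x) - x).
Proof. by apply/qpi_eq; rewrite /qpi reprK. Qed.

Lemma qpiD x y : qadd (qpi x) (qpi y) = qpi (x + y).
Proof. by apply/qpi_eq; rewrite opprD addrACA; apply: idealD; apply: repr_qpi. Qed.
Lemma qpiN x : qopp (qpi x) = qpi (- x).
Proof. by apply/qpi_eq; rewrite -opprD; apply/idealN/repr_qpi. Qed.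
Lemma qpiM x y : qmul (qpi x) (qpi y) = qpi (x * y).
Proof.
apply/qpi_eq; set a := repr _; set b := repr _.
have -> : a * b - x * y = b * (a - x) + x * (b - y).
  by rewrite !mulrBr addrA (mulrC b x) subrK (mulrC b a).
by apply: idealD; apply: idealM; apply: repr_qpi.
Qed.

Fact qaddA : associative qadd.
Proof.
move=> u v w; have [x ->] := qpi_surj u; have [y ->] := qpi_surj v.
by have [z ->] := qpi_surj w; rewrite !qpiD addrA.
Qed.
Fact qaddC : commutative qadd.
Proof.
by move=> u v; have [x ->] := qpi_surj u; have [y ->] := qpi_surj v;
  rewrite !qpiD addrC.
Qed.
Fact qadd0 : left_id (qpi 0) qadd.
Proof. by move=> u; have [x ->] := qpi_surj u; rewrite qpiD add0r. Qed.
Fact qaddN : left_inverse (qpi 0) qopp qadd.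
Proof. by move=> u; have [x ->] := qpi_surj u; rewrite qpiN qpiD addNr. Qed.
HB.instance Definition _ :=
  GRing.isZmodule.Build quot qaddA qaddC qadd0 qaddN.

Fact qmulA : associative qmul.
Proof.
move=> u v w; have [x ->] := qpi_surj u; have [y ->] := qpi_surj v.
by have [z ->] := qpi_surj w; rewrite !qpiM mulrA.
Qed.
Fact qmulC : commutative qmul.
Proof.
by move=> u v; have [x ->] := qpi_surj u; have [y ->] := qpi_surj v;
  rewrite !qpiM mulrC.
Qed.
Fact qmul1 : left_id (qpi 1) qmul.
Proof. by move=> u; have [x ->] := qpi_surj u; rewrite qpiM mul1r. Qed.
Fact qmulD : left_distributive qmul qadd.
Proof.
move=> u v w; have [x ->] := qpi_surj u; have [y ->] := qpi_surj v.
by have [z ->] := qpi_surj w; rewrite !(qpiM, qpiD) mulrDl.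
Qed.
HB.instance Definition _ :=
  GRing.Zmodule_isComPzRing.Build quot qmulA qmulC qmul1 qmulD.

Fact qpi_zmod_morphism : zmod_morphism qpi.
Proof. by move=> x y; rewrite -qpiD -qpiN. Qed.
Fact qpi_monoid_morphism : monoid_morphism qpi.
Proof. by split=> // x y; rewrite -qpiM. Qed.
HB.instance Definition _ := GRing.isZmodMorphism.Build A quot qpi qpi_zmod_morphism.
HB.instance Definition _ :=
  GRing.isMonoidMorphism.Build A quot qpi qpi_monoid_morphism.

End Quotient.

(*  The J-adic completion, as the inverse limit of the A / J^k                *)

Record completion (A : comPzRingType) (J : set A) := Completion {
  cseq : forall k, quot (iexp J k);
  cseqP : forall k, exists a,
    cseq k = qpi (iexp J k) a /\ cseq k.+1 = qpi (iexp J k.+1) a }.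

Section Completion.
Variables (A : comPzRingType) (J : set A).
Local Notation cA := (completion J).
HB.instance Definition _ := gen_eqMixin cA.
HB.instance Definition _ := gen_choiceMixin cA.

Lemma cseq_inj (u v : cA) : (forall k, cseq u k = cseq v k) -> u = v.
Proof.
case: u v => [u Pu] [v Pv] /= h; have e : u = v by apply: functional_extensionality_dep.
by case: _ / e Pv => Pv; congr Completion; apply: Prop_irrelevance.
Qed.

Fact ccst_subproof a : forall k, exists b,
  qpi (iexp J k) a = qpi (iexp J k) b /\ qpi (iexp J k.+1) a = qpi (iexp J k.+1) b.
Proof. by move=> k; exists a. Qed.
Definition to_completion (a : A) : cA := Completion (@ccst_subproof a).

Fact cadd_subproof (u v : cA) : forall k, exists b,
  cseq u k + cseq v k = qpi (iexp J k) b /\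
  cseq u k.+1 + cseq v k.+1 = qpi (iexp J k.+1) b.
Proof.
move=> k; have [a [-> ->]] := cseqP u k; have [b [-> ->]] := cseqP v k.
by exists (a + b); rewrite !rmorphD.
Qed.
Definition cadd u v := Completion (@cadd_subproof u v).

Fact copp_subproof (u : cA) : forall k, exists b,
  - cseq u k = qpi (iexp J k) b /\ - cseq u k.+1 = qpi (iexp J k.+1) b.
Proof.
by move=> k; have [a [-> ->]] := cseqP u k; exists (- a); rewrite !rmorphN.
Qed.
Definition copp u := Completion (@copp_subproof u).

Fact cmul_subproof (u v : cA) : forall k, exists b,
  cseq u k * cseq v k = qpi (iexp J k) b /\
  cseq u k.+1 * cseq v k.+1 = qpi (iexp J k.+1) b.
Proof.
move=> k; have [a [-> ->]] := cseqP u k; have [b [-> ->]] := cseqP v k.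
by exists (a * b); rewrite !rmorphM.
Qed.
Definition cmul u v := Completion (@cmul_subproof u v).

Fact caddA : associative cadd.
Proof. by move=> u v w; apply: cseq_inj => k /=; rewrite addrA. Qed.
Fact caddC : commutative cadd.
Proof. by move=> u v; apply: cseq_inj => k /=; rewrite addrC. Qed.
Fact cadd0 : left_id (to_completion 0) cadd.
Proof. by move=> u; apply: cseq_inj => k /=; rewrite rmorph0 add0r. Qed.
Fact caddN : left_inverse (to_completion 0) copp cadd.
Proof. by move=> u; apply: cseq_inj => k /=; rewrite rmorph0 addNr. Qed.
HB.instance Definition _ := GRing.isZmodule.Build cA caddA caddC cadd0 caddN.

Fact cmulA : associative cmul.
Proof. by move=> u v w; apply: cseq_inj => k /=; rewrite mulrA. Qed.
Fact cmulC : commutative cmul.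
Proof. by move=> u v; apply: cseq_inj => k /=; rewrite mulrC. Qed.
Fact cmul1 : left_id (to_completion 1) cmul.
Proof. by move=> u; apply: cseq_inj => k /=; rewrite rmorph1 mul1r. Qed.
Fact cmulD : left_distributive cmul cadd.
Proof. by move=> u v w; apply: cseq_inj => k /=; rewrite mulrDl. Qed.
HB.instance Definition _ :=
  GRing.Zmodule_isComPzRing.Build cA cmulA cmulC cmul1 cmulD.

Fact to_completion_zmod_morphism : zmod_morphism to_completion.
Proof. by move=> x y; apply: cseq_inj => k /=; rewrite rmorphB. Qed.
Fact to_completion_monoid_morphism : monoid_morphism to_completion.
Proof. by split=> // x y; apply: cseq_inj => k /=; rewrite rmorphM. Qed.
HB.instance Definition _ :=
  GRing.isZmodMorphism.Build A cA to_completion to_completion_zmod_morphism.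
HB.instance Definition _ :=
  GRing.isMonoidMorphism.Build A cA to_completion to_completion_monoid_morphism.

End Completion.

Definition is_complete (A : comPzRingType) (J : set A) : Prop :=
  bijective (to_completion J).

Definition is_maximal (A : comPzRingType) (M : ideal A) : Prop :=
  ~ M 1 /\ forall J : ideal A, M `<=` J -> J 1 \/ J `<=` M.

Definition is_local (A : comPzRingType) (M : ideal A) : Prop :=
  is_maximal M /\ forall M' : ideal A, is_maximal M' -> M' `<=>` M.

Definition is_noetherian (A : comPzRingType) : Prop :=
  forall I : ideal A, exists s : seq A, I `<=>` igen [set x | x \in s].

Definition is_dvr (V : idomainType) (M : ideal V) : Prop :=
  [/\ forall I : ideal V, exists a : V, I `<=>` igen [set a],
      is_local M
    & exists2 a, M a & a != 0].

Definition has_characteristic (A : comPzRingType) (c : nat) : Prop :=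
  forall n : nat, n%:R = 0 :> A <-> (c %| n)%N.

Definition is_unramified_cdvr (p : nat) (V : idomainType) : Prop :=
  [/\ prime p, has_characteristic V 0, is_dvr (igen [set p%:R : V])
    & is_complete (igen [set p%:R : V])].

Definition is_subfield (A : comPzRingType) (K : set A) : Prop :=
  [/\ K 1 /\ 1 != 0 :> A, forall x y, K x -> K y -> K (x - y),
      forall x y, K x -> K y -> K (x * y)
    & forall x, K x -> x != 0 -> exists2 y, K y & x * y = 1].

Definition is_mixed_characteristic (p : nat) (A : comPzRingType) (M : ideal A) :
    Prop :=
  [/\ prime p, has_characteristic (quot M) p,
      has_characteristic A 0 \/
        exists2 m, (1 < m)%N & has_characteristic A (p ^ m)
    & ~ exists K : set A, is_subfield K].

Record fps (A : comNzRingType) := Fps { fcoef : nat -> A }.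

Section Fps.
Variable A : comNzRingType.
Implicit Types f g h : fps A.
HB.instance Definition _ := gen_eqMixin (fps A).
HB.instance Definition _ := gen_choiceMixin (fps A).

Lemma fps_ext f g : (forall k, fcoef f k = fcoef g k) -> f = g.
Proof. by case: f g => f [g] /= /funext ->. Qed.

Definition fpsC (a : A) : fps A := Fps (fun k => if k == 0%N then a else 0).
Definition fpsX : fps A := Fps (fun k => (k == 1%N)%:R).
Definition fadd f g : fps A := Fps (fun k => fcoef f k + fcoef g k).
Definition fopp f : fps A := Fps (fun k => - fcoef f k).
Definition fmul f g : fps A :=
  Fps (fun k => \sum_(i < k.+1) fcoef f i * fcoef g (k - i)).

Fact faddA : associative fadd.
Proof. by move=> f g h; apply: fps_ext => k /=; rewrite addrA. Qed.
Fact faddC : commutative fadd.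
Proof. by move=> f g; apply: fps_ext => k /=; rewrite addrC. Qed.
Fact fadd0 : left_id (fpsC 0) fadd.
Proof. by move=> f; apply: fps_ext => k /=; rewrite if_same add0r. Qed.
Fact faddN : left_inverse (fpsC 0) fopp fadd.
Proof. by move=> f; apply: fps_ext => k /=; rewrite if_same addNr. Qed.
HB.instance Definition _ := GRing.isZmodule.Build (fps A) faddA faddC fadd0 faddN.

Definition ftrunc n f : {poly A} := \poly_(i < n.+1) fcoef f i.

Lemma coef_ftrunc n f k : (k <= n)%N -> (ftrunc n f)`_k = fcoef f k.
Proof. by move=> kn; rewrite coef_poly ltnS kn. Qed.

Lemma fmul_trunc n f g k : (k <= n)%N ->
  fcoef (fmul f g) k = (ftrunc n f * ftrunc n g)`_k.
Proof.
move=> kn; rewrite coefM; apply: eq_bigr => i _.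
by rewrite !coef_ftrunc // (leq_trans _ kn) ?leq_subr // -ltnS.
Qed.

Fact fmulA : associative fmul.
Proof.
move=> f g h; apply: fps_ext => k; rewrite /= -/(fmul _ _).
transitivity ((ftrunc k f * (ftrunc k g * ftrunc k h))`_k).
  rewrite coefM; apply: eq_bigr => i _; have ik : (i <= k)%N by rewrite -ltnS.
  by rewrite coef_ftrunc // -fmul_trunc // leq_subr.
rewrite mulrA coefM; apply: eq_bigr => i _; have ik : (i <= k)%N by rewrite -ltnS.
by rewrite -fmul_trunc // coef_ftrunc // leq_subr.
Qed.
Fact fmulC : commutative fmul.
Proof.
by move=> f g; apply: fps_ext => k; rewrite !(fmul_trunc _ _ (leqnn k)) mulrC.
Qed.
Fact fmul1 : left_id (fpsC 1) fmul.
Proof.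
move=> f; apply: fps_ext => k /=; rewrite big_ord_recl /= mul1r subn0.
by rewrite big1 ?addr0 // => i _; rewrite mul0r.
Qed.
Fact fmulD : left_distributive fmul fadd.
Proof.
move=> f g h; apply: fps_ext => k /=; rewrite -big_split /=.
by apply: eq_bigr => i _; rewrite mulrDl.
Qed.
Fact fone_neq0 : fpsC 1 != 0.
Proof. by apply/eqP => /(congr1 (fun f => fcoef f 0)) /= /eqP; rewrite oner_eq0. Qed.
HB.instance Definition _ :=
  GRing.Zmodule_isComNzRing.Build (fps A) fmulA fmulC fmul1 fmulD fone_neq0.

Lemma fcoefD f g k : fcoef (f + g) k = fcoef f k + fcoef g k.
Proof. by []. Qed.
Lemma fcoefM f g k :
  fcoef (f * g) k = \sum_(i < k.+1) fcoef f i * fcoef g (k - i).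
Proof. by []. Qed.

Fact fpsC_zmod_morphism : zmod_morphism fpsC.
Proof. by move=> a b; apply: fps_ext => -[|k] /=; rewrite ?subr0. Qed.
Fact fpsC_monoid_morphism : monoid_morphism fpsC.
Proof.
split=> // a b; apply: fps_ext => k; rewrite fcoefM big_ord_recl /= subn0.
by rewrite big1 ?addr0 => [|i _]; [case: k => //= k; rewrite mulr0|rewrite mul0r].
Qed.
HB.instance Definition _ :=
  GRing.isZmodMorphism.Build A (fps A) fpsC fpsC_zmod_morphism.
HB.instance Definition _ :=
  GRing.isMonoidMorphism.Build A (fps A) fpsC fpsC_monoid_morphism.

End Fps.
Arguments fpsX {A}.

Section FpsMap.
Variables (A B : comNzRingType) (s : {rmorphism A -> B}).

Definition fps_map (f : fps A) : fps B := Fps (fun k => s (fcoef f k)).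

Fact fps_map_zmod_morphism : zmod_morphism fps_map.
Proof. by move=> f g; apply: fps_ext => k /=; rewrite rmorphB. Qed.
Fact fps_map_monoid_morphism : monoid_morphism fps_map.
Proof.
split; first by apply: fps_ext => -[|k] /=; rewrite ?rmorph1 ?rmorph0.
move=> f g; apply: fps_ext => k; rewrite /= rmorph_sum.
by apply: eq_bigr => i _; rewrite rmorphM.
Qed.
HB.instance Definition _ :=
  GRing.isZmodMorphism.Build (fps A) (fps B) fps_map fps_map_zmod_morphism.
HB.instance Definition _ :=
  GRing.isMonoidMorphism.Build (fps A) (fps B) fps_map fps_map_monoid_morphism.
End FpsMap.

(* V((t)) = V[[t]][t^-1], presented as V[[t]][Y] / (tY - 1) *)
Definition laurent_ideal (V : comNzRingType) : ideal {poly (fps V)} :=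
  igen [set (fpsX : fps V)%:P * 'X - 1].
Definition laurent (V : comNzRingType) := quot (laurent_ideal V).
HB.instance Definition _ (V : comNzRingType) := GRing.ComPzRing.on (laurent V).

Definition laurent_of_fps (V : comNzRingType) : {rmorphism fps V -> laurent V} :=
  (qpi (laurent_ideal V) \o polyC)%FUN.

Definition laurentC (V : comNzRingType) : {rmorphism V -> laurent V} :=
  (laurent_of_fps V \o @fpsC V)%FUN.

(*  Power series in n variables. mps V n.+1 is (mps V n)[[x]], where x is the *)
(*  variable of index ord0; the variable of index lift ord0 i is the i-th one *)
(*  of mps V n.                                                               *)

Fixpoint mps (V : comNzRingType) (n : nat) : comNzRingType :=
  if n is k.+1 then fps (mps V k) else V.

Section Mps.
Variable V : comNzRingType.

Fixpoint mpsC n : {rmorphism V -> mps V n} :=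
  match n return {rmorphism V -> mps V n} with
  | 0 => idfun
  | k.+1 => (@fpsC (mps V k) \o mpsC k)%FUN
  end.

Fixpoint mpsX n : 'I_n -> mps V n :=
  match n return 'I_n -> mps V n with
  | 0 => fun _ => 0
  | k.+1 => fun i => if unlift ord0 i is Some j then fpsC (mpsX j) else fpsX
  end.

Definition xideal n : ideal (mps V n) := igen (range (@mpsX n)).

Definition is_order n (f : mps V n) (i : nat) : Prop :=
  iexp (xideal n) i f /\ forall j, iexp (xideal n) j f -> (j <= i)%N.

(* the homogeneous component of degree d *)
Fixpoint hpart n (d : nat) : mps V n -> mps V n :=
  match n return mps V n -> mps V n with
  | 0 => fun v => if d == 0%N then v else 0
  | k.+1 => fun f =>
      Fps (fun j => if (j <= d)%N then hpart (d - j) (fcoef f j) else 0)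
  end.

(* f(x_1 t, ..., x_n t) = \sum_d (hpart d f) t^d; see psi_mpsC and psi_mpsX *)
Definition psi n (f : mps V n) : fps (mps V n) := Fps (fun d => hpart d f).

Lemma hpartB n d : zmod_morphism (@hpart n d).
Proof.
elim: n d => [|n IH] d f g /=; first by case: ifP => // _; rewrite subr0.
by apply: fps_ext => j /=; case: ifP => // _; rewrite ?subr0 // -IH.
Qed.

HB.instance Definition _ n d :=
  GRing.isZmodMorphism.Build (mps V n) (mps V n) (@hpart n d) (@hpartB n d).

Lemma hpart1 n d : hpart d (1 : mps V n) = (d == 0%N)%:R.
Proof.
elim: n d => [|n IH] d /=; first by case: eqP.
apply: fps_ext => -[|j] /=; first by rewrite subn0 IH; case: eqP.
by case: eqP => [->|_] //=; case: ifP => // _; rewrite raddf0.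
Qed.

Lemma hpartM n d (f g : mps V n) :
  hpart d (f * g) = \sum_(e < d.+1) hpart e f * hpart (d - e) g.
Proof.
elim: n d f g => [|n IH] d f g.
  rewrite big_ord_recl /= subn0 big1 ?addr0 => [|i _]; last by rewrite mul0r.
  by case: eqP => _; rewrite ?mulr0.
have fcoef_sum (I : finType) (F : I -> fps (mps V n)) k :
    fcoef (\sum_i F i) k = \sum_i fcoef (F i) k.
  by apply: (big_morph (fun f => fcoef f k)) => //=; rewrite if_same.
apply: fps_ext => k; rewrite fcoef_sum /=.
rewrite exchange_big /=; case: leqP => kd; last first.
  rewrite big1 // => j _; rewrite big1 // => e _.
  have jk : (j <= k)%N by rewrite -ltnS.
  have ed : (e <= d)%N by rewrite -ltnS.
  case: (leqP j e) => je; rewrite ?mul0r //=.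
  by case: (leqP (k - j) (d - e)) => h; rewrite ?mulr0 //=; lia.
rewrite raddf_sum; apply: eq_bigr => j _; have jk : (j <= k)%N by rewrite -ltnS.
apply: etrans (IH _ _ _) _.
pose G (e : nat) : mps V n := (if (j <= e)%N then hpart (e - j) (fcoef f j) else 0) *
  (if (k - j <= d - e)%N then hpart (d - e - (k - j)) (fcoef g (k - j)) else 0).
rewrite -(big_mkord xpredT (fun e => hpart e (fcoef f j) *
   hpart (d - k - e) (fcoef g (k - j)))) -(big_mkord xpredT G).
rewrite [RHS](big_cat_nat _ (n := j)) ?leq0n //=; last lia.
rewrite [X in _ = X + _]big_nat [X in _ = X + _]big1 ?add0r => [|e /andP[_ ej]]; last first.
  by rewrite /G leqNgt ej mul0r.
rewrite [RHS](big_cat_nat _ (n := (d - k + j).+1)) //=; try lia.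
rewrite [X in _ = _ + X]big_nat [X in _ = _ + X]big1 ?addr0 => [|e /andP[h1 h2]]; last first.
  by rewrite /G; case: (leqP (k - j)) => h; rewrite ?mulr0 //; lia.
rewrite -[X in \sum_(X <= i < _) G i]add0n -addSn big_addn addnK; apply: eq_big_nat => e /andP[_ he].
rewrite /G leq_addl addnK; case: leqP => h; last lia.
by congr (_ * hpart _ _); lia.
Qed.

Fact psi_zmod_morphism n : zmod_morphism (@psi n).
Proof. by move=> f g; apply: fps_ext => d /=; rewrite raddfB. Qed.
Fact psi_monoid_morphism n : monoid_morphism (@psi n).
Proof.
split; first by apply: fps_ext => -[|d]; rewrite /= hpart1.
by move=> f g; apply: fps_ext => d; rewrite /= hpartM.
Qed.
HB.instance Definition _ n :=
  GRing.isZmodMorphism.Build (mps V n) (fps (mps V n)) (@psi n)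
    (@psi_zmod_morphism n).
HB.instance Definition _ n :=
  GRing.isMonoidMorphism.Build (mps V n) (fps (mps V n)) (@psi n)
    (@psi_monoid_morphism n).

Lemma hpart_mpsC n d v : hpart d (mpsC n v) = if d == 0%N then mpsC n v else 0.
Proof.
elim: n d => [|n IH] d //=; apply: fps_ext => -[|j] /=.
  by rewrite subn0 IH; case: eqP.
by rewrite raddf0 if_same; case: eqP.
Qed.

Lemma hpart_mpsX n d (i : 'I_n) :
  hpart d (mpsX i) = if d == 1%N then mpsX i else 0.
Proof.
elim: n d i => [d []//|n IH] d i /=; case: unliftP => [j _|_].
  apply: fps_ext => -[|k] /=; first by rewrite subn0 IH; case: eqP.
  by rewrite raddf0 if_same; case: eqP.
apply: fps_ext => -[|[|k]] /=; rewrite ?raddf0 ?if_same; try by case: eqP.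
by rewrite hpart1; case: d => [|[|d]].
Qed.

Lemma psi_mpsC n v : psi (mpsC n v) = fpsC (mpsC n v).
Proof. by apply: fps_ext => d /=; rewrite hpart_mpsC. Qed.

Lemma psi_mpsX n (i : 'I_n) : psi (mpsX i) = fpsC (mpsX i) * fpsX.
Proof.
apply: fps_ext => d; rewrite /= hpart_mpsX big_ord_recl /= subn0.
rewrite big1 ?addr0 => [|j _]; last by rewrite mul0r.
by case: eqP => _; rewrite ?mulr1 ?mulr0.
Qed.

(* the second condition says that h = t^{-o(f)} psi(f) *)
Definition is_hom n (f : mps V n) (h : fps (mps V n)) : Prop :=
  exists2 i, is_order f i & fpsX ^+ i * h = psi f.

Definition hom_ideal n (L : set (mps V n)) : ideal (fps (mps V n)) :=
  igen [set h | exists f, [/\ L f, f != 0 & is_hom f h]].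

End Mps.

(*  The associated graded ring of an ideal M, obtained from the Rees algebra  *)
(*  \bigoplus_i M^i X^i of {poly A} as                                        *)
(*        (\bigoplus_i M^i X^i) / (\bigoplus_i M^i.+1 X^i)                    *)

Section Graded.
Variables (A : comNzRingType) (M : ideal A).

Definition rees_pred : {pred {poly A}} := fun f => `[< forall i, iexp M i f`_i >].

Lemma rees_predP (f : {poly A}) :
  reflect (forall i, iexp M i f`_i) (f \in rees_pred).
Proof. exact: asboolP. Qed.

Fact rees_subring_closed : subring_closed rees_pred.
Proof.
split=> [|f g /rees_predP hf /rees_predP hg|f g /rees_predP hf /rees_predP hg].
- by apply/rees_predP => -[|i] //; rewrite coef1; apply: ideal0.
- by apply/rees_predP => i; rewrite coefB; apply: idealB.
apply/rees_predP => i; rewrite coefM.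
apply: (big_ind (iexp M i)); [exact: ideal0|exact: idealD|] => j _.
have -> : iexp M i = iexp M (j + (i - j)) by rewrite subnKC // -ltnS.
exact: iexpM.
Qed.
HB.instance Definition _ :=
  GRing.isSubringClosed.Build {poly A} rees_pred rees_subring_closed.

Definition rees := {f : {poly A} | f \in rees_pred}.
HB.instance Definition _ := Choice.on rees.
HB.instance Definition _ := SubChoice.on rees.
HB.instance Definition _ :=
  GRing.SubChoice_isSubComPzRing.Build {poly A} rees_pred rees
    (subringClosedP rees_pred).

Fact gr_is_ideal : is_ideal [set f : rees | forall i, iexp M i.+1 (val f)`_i].
Proof.
rewrite /mkset; split=> [i|f g hf hg i|a f hf i].
- by rewrite rmorph0 coef0; apply: ideal0.
- by rewrite rmorphD coefD; apply: idealD.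
rewrite rmorphM coefM.
apply: (big_ind (imul M (iexp M i))); [exact: ideal0|exact: idealD|] => j _.
have /rees_predP ha := valP a.
have -> : imul M (iexp M i) = iexp M (j + (i - j).+1).
  by rewrite addnS subnKC // -ltnS.
exact: iexpM.
Qed.
Definition gr_ideal : ideal rees := Ideal gr_is_ideal.

Definition gr := quot gr_ideal.
HB.instance Definition _ := GRing.ComPzRing.on gr.

(* G_+, the classes of the elements with zero component in degree 0 *)
Definition gr_plus : set gr :=
  [set qpi gr_ideal f | f in [set f : rees | (val f)`_0 = 0]].

Fact gr0_subproof (a : A) : a%:P \in rees_pred.
Proof. by apply/rees_predP => -[|i] //; rewrite coefC; apply: ideal0. Qed.

(* the ring morphism from A onto the component A / M of degree 0 *)
Definition gr0 (a : A) : gr := qpi gr_ideal (Sub a%:P (gr0_subproof a)).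

End Graded.

(*  The tensor product of two commutative C-algebras f : C -> A, g : C -> B.  *)
(*  The sequence [:: (a1, b1); ...; (an, bn)] stands for the tensor           *)
(*  a1 (x) b1 + ... + an (x) bn.                                              *)

Section Tensor.
Variables (C A B : comPzRingType) (f : {rmorphism C -> A}) (g : {rmorphism C -> B}).
Local Notation W := (seq (A * B)%type).

Inductive tens_eq : W -> W -> Prop :=
| tens_refl s : tens_eq s s
| tens_sym s t : tens_eq s t -> tens_eq t s
| tens_trans s t u : tens_eq s t -> tens_eq t u -> tens_eq s u
| tens_cat s s' t t' : tens_eq s s' -> tens_eq t t' -> tens_eq (s ++ t) (s' ++ t')
| tens_catC s t : tens_eq (s ++ t) (t ++ s)
| tens_Dl a a' b : tens_eq [:: (a + a', b)] [:: (a, b); (a', b)]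
| tens_Dr a b b' : tens_eq [:: (a, b + b')] [:: (a, b); (a, b')]
| tens_scal c a b : tens_eq [:: (f c * a, b)] [:: (a, g c * b)]
| tens_0 b : tens_eq [:: (0, b)] [::].

Definition tens_rel : rel W := fun s t => `[< tens_eq s t >].
Fact tens_rel_equiv : equiv_class_of tens_rel.
Proof.
split=> [s|s t|t s u]; first exact/asboolP/tens_refl.
- by apply/asboolP/asboolP; apply: tens_sym.
- by move=> /asboolP h1 /asboolP h2; apply/asboolP/(tens_trans h1).
Qed.
Canonical tens_equivRel := EquivRelPack tens_rel_equiv.

Definition tensor := {eq_quot tens_rel}.
HB.instance Definition _ := Choice.on tensor.
HB.instance Definition _ := EqQuotient.on tensor.

Definition tpi (s : W) : tensor := \pi_tensor s.

Lemma tpi_eq s t : tpi s = tpi t <-> tens_eq s t.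
Proof.
by split=> [/eqP|h]; [rewrite /tpi eqmodE => /asboolP
                    | apply/eqP; rewrite /tpi eqmodE; apply/asboolP].
Qed.
Lemma tpi_surj (u : tensor) : exists s, u = tpi s.
Proof. by exists (repr u); rewrite /tpi reprK. Qed.
Lemma repr_tpi s : tens_eq (repr (tpi s)) s.
Proof. by apply/tpi_eq; rewrite /tpi reprK. Qed.

Definition wopp (s : W) : W := [seq (- x.1, x.2) | x <- s].
Definition wmul (s t : W) : W := [seq (x.1 * y.1, x.2 * y.2) | x <- s, y <- t].

Lemma wopp_eq s t : tens_eq s t -> tens_eq (wopp s) (wopp t).
Proof.
elim=> {s t} /=.
- by move=> s; apply: tens_refl.
- by move=> s t _; apply: tens_sym.
- by move=> s t u _ h _; apply: tens_trans h.
- by move=> s s' t t' _ h1 _ h2; rewrite /wopp !map_cat; apply: tens_cat.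
- by move=> s t; rewrite /wopp !map_cat; apply: tens_catC.
- by move=> a a' b; rewrite opprD; apply: tens_Dl.
- by move=> a b b'; apply: tens_Dr.
- by move=> c a b; rewrite -mulrN; apply: tens_scal.
- by move=> b; rewrite oppr0; apply: tens_0.
Qed.

Lemma wopp_addl s : tens_eq (wopp s ++ s) [::].
Proof.
elim: s => [|[a b] s IH] /=; first exact: tens_refl.
apply: (tens_trans (t := [:: (- a, b); (a, b)] ++ (wopp s ++ s))); last first.
  rewrite -[[::]]cats0; apply: tens_cat => //.
  by apply: tens_trans (tens_sym (tens_Dl _ _ _)) _; rewrite addNr; apply: tens_0.
rewrite /= -cat1s -[X in tens_eq _ X]cat1s; apply: tens_cat; first exact: tens_refl.
rewrite -cat1s catA -[X in tens_eq _ X]cat1s [X in tens_eq _ X]catA.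
by apply: tens_cat; [apply: tens_catC|apply: tens_refl].
Qed.

Lemma wmul_catl s t u : wmul (s ++ t) u = wmul s u ++ wmul t u.
Proof. by rewrite /wmul allpairs_cat. Qed.

Lemma wmul1 x t : wmul [:: x] t = [seq (x.1 * y.1, x.2 * y.2) | y <- t].
Proof. by rewrite /wmul /= cats0. Qed.

Lemma tens_insert x s t : tens_eq (s ++ x :: t) (x :: s ++ t).
Proof.
rewrite -cat1s catA -[X in tens_eq _ X]cat1s catA.
by apply: tens_cat; [apply: tens_catC|apply: tens_refl].
Qed.

Lemma wmulC s t : tens_eq (wmul s t) (wmul t s).
Proof.
elim: s t => [|x s IH] t.
  by rewrite /wmul /=; elim: t => [|y t IH] /=; first exact: tens_refl.
rewrite -cat1s wmul_catl.
apply: (tens_trans (t := wmul [:: x] t ++ wmul t s)).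
  by apply: tens_cat; [apply: tens_refl|].
rewrite wmul1 {IH}; elim: t => [|y t IH] /=; first exact: tens_refl.
rewrite -[wmul (y :: t) s]/(wmul ([:: y] ++ t) s) -[wmul (y :: t) _]/(wmul ([:: y] ++ t) _).
rewrite !wmul_catl !wmul1 /= (mulrC y.1) (mulrC y.2).
rewrite -cat1s -[X in tens_eq _ X]cat1s; apply: tens_cat; first exact: tens_refl.
rewrite catA; apply: tens_trans (tens_cat (tens_catC _ _) (tens_refl _)) _.
by rewrite -catA; apply: tens_cat => //; apply: tens_refl.
Qed.

Lemma wmul_eq1 x s t : tens_eq s t -> tens_eq (wmul [:: x] s) (wmul [:: x] t).
Proof.
rewrite !wmul1; elim=> {s t} /=.
- by move=> s; apply: tens_refl.
- by move=> s t _; apply: tens_sym.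
- by move=> s t u _ h _; apply: tens_trans h.
- by move=> s s' t t' _ h1 _ h2; rewrite !map_cat; apply: tens_cat.
- by move=> s t; rewrite !map_cat; apply: tens_catC.
- by move=> a a' b; rewrite mulrDr; apply: tens_Dl.
- by move=> a b b'; rewrite mulrDr; apply: tens_Dr.
- by move=> c a b; rewrite (mulrCA _ (f c)) (mulrCA _ (g c)); apply: tens_scal.
- by move=> b; rewrite mulr0; apply: tens_0.
Qed.

Lemma wmul_eqr u s t : tens_eq s t -> tens_eq (wmul u s) (wmul u t).
Proof.
move=> h; elim: u => [|x u IH]; first exact: tens_refl.
rewrite -[wmul (x :: u) s]/(wmul ([:: x] ++ u) s) -[wmul (x :: u) t]/(wmul ([:: x] ++ u) t).
by rewrite !wmul_catl; apply: tens_cat => //; apply: wmul_eq1.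
Qed.

Lemma wmul_eq s s' t t' : tens_eq s s' -> tens_eq t t' ->
  tens_eq (wmul s t) (wmul s' t').
Proof.
move=> h1 h2; apply: tens_trans (wmul_eqr _ h2) _.
by apply: tens_trans (wmulC _ _) _; apply: tens_trans (wmul_eqr _ h1) (wmulC _ _).
Qed.

Lemma wmulA s t u : wmul s (wmul t u) = wmul (wmul s t) u.
Proof.
elim: s => [|x s IH] //.
rewrite -cat1s 3!wmul_catl IH; congr (_ ++ _); rewrite !wmul1.
have wcons z r : wmul (z :: r) u =
  [seq (z.1 * w.1, z.2 * w.2) | w <- u] ++ wmul r u by [].
elim: t {IH} => [|y t IH] //; rewrite wcons map_cat IH -map_comp.
rewrite [RHS]wcons; congr (_ ++ _).
by elim: u {IH wcons} => [|z u IHu] //=; rewrite IHu !mulrA.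
Qed.

Lemma wmul1l s : wmul [:: (1, 1)] s = s.
Proof. by rewrite wmul1 -[RHS]map_id; apply: eq_map => -[a b] /=; rewrite !mul1r. Qed.

Definition tadd (u v : tensor) := tpi (repr u ++ repr v).
Definition topp (u : tensor) := tpi (wopp (repr u)).
Definition tmul (u v : tensor) := tpi (wmul (repr u) (repr v)).

Lemma tpiD s t : tadd (tpi s) (tpi t) = tpi (s ++ t).
Proof. by apply/tpi_eq; apply: tens_cat; apply: repr_tpi. Qed.
Lemma tpiN s : topp (tpi s) = tpi (wopp s).
Proof. by apply/tpi_eq; apply/wopp_eq/repr_tpi. Qed.
Lemma tpiM s t : tmul (tpi s) (tpi t) = tpi (wmul s t).
Proof. by apply/tpi_eq; apply: wmul_eq; apply: repr_tpi. Qed.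

Fact taddA : associative tadd.
Proof.
move=> u v w; have [x ->] := tpi_surj u; have [y ->] := tpi_surj v.
by have [z ->] := tpi_surj w; rewrite !tpiD catA.
Qed.
Fact taddC : commutative tadd.
Proof.
move=> u v; have [x ->] := tpi_surj u; have [y ->] := tpi_surj v.
by rewrite !tpiD; apply/tpi_eq/tens_catC.
Qed.
Fact tadd0 : left_id (tpi [::]) tadd.
Proof. by move=> u; have [x ->] := tpi_surj u; rewrite tpiD. Qed.
Fact taddN : left_inverse (tpi [::]) topp tadd.
Proof.
by move=> u; have [x ->] := tpi_surj u; rewrite tpiN tpiD; apply/tpi_eq/wopp_addl.
Qed.
HB.instance Definition _ := GRing.isZmodule.Build tensor taddA taddC tadd0 taddN.

Fact tmulA : associative tmul.
Proof.
move=> u v w; have [x ->] := tpi_surj u; have [y ->] := tpi_surj v.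
by have [z ->] := tpi_surj w; rewrite !tpiM wmulA.
Qed.
Fact tmulC : commutative tmul.
Proof.
move=> u v; have [x ->] := tpi_surj u; have [y ->] := tpi_surj v.
by rewrite !tpiM; apply/tpi_eq/wmulC.
Qed.
Fact tmul1 : left_id (tpi [:: (1, 1)]) tmul.
Proof. by move=> u; have [x ->] := tpi_surj u; rewrite tpiM wmul1l. Qed.
Fact tmulD : left_distributive tmul tadd.
Proof.
move=> u v w; have [x ->] := tpi_surj u; have [y ->] := tpi_surj v.
by have [z ->] := tpi_surj w; rewrite !(tpiM, tpiD) wmul_catl.
Qed.
HB.instance Definition _ :=
  GRing.Zmodule_isComPzRing.Build tensor tmulA tmulC tmul1 tmulD.

Definition tens (a : A) (b : B) : tensor := tpi [:: (a, b)].

Definition tensl (a : A) : tensor := tens a 1.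
Definition tensr (b : B) : tensor := tens 1 b.

Lemma tens_0r a : tens_eq [:: (a, 0)] [::].
Proof.
rewrite -(mul0r 0) -(rmorph0 g); apply: tens_trans (tens_sym (tens_scal _ _ _)) _.
by rewrite rmorph0 mul0r; apply: tens_0.
Qed.

Fact tensl_zmod_morphism : zmod_morphism tensl.
Proof.
move=> a b; rewrite -[RHS]/(tadd _ (topp _)) tpiN tpiD.
by apply/tpi_eq; apply: tens_Dl.
Qed.
Fact tensl_monoid_morphism : monoid_morphism tensl.
Proof. by split=> // a b; rewrite -[RHS]/(tmul _ _) tpiM wmul1 /= mulr1. Qed.
HB.instance Definition _ :=
  GRing.isZmodMorphism.Build A tensor tensl tensl_zmod_morphism.
HB.instance Definition _ :=
  GRing.isMonoidMorphism.Build A tensor tensl tensl_monoid_morphism.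

Fact tensr_zmod_morphism : zmod_morphism tensr.
Proof.
move=> a b; apply/eqP; rewrite eq_sym subr_eq; apply/eqP.
rewrite -[RHS]/(tadd _ _) tpiD -{1}[a](subrK b).
by apply/tpi_eq; apply: tens_Dr.
Qed.
Fact tensr_monoid_morphism : monoid_morphism tensr.
Proof. by split=> // a b; rewrite -[RHS]/(tmul _ _) tpiM wmul1 /= mulr1. Qed.
HB.instance Definition _ :=
  GRing.isZmodMorphism.Build B tensor tensr tensr_zmod_morphism.
HB.instance Definition _ :=
  GRing.isMonoidMorphism.Build B tensor tensr tensr_monoid_morphism.

End Tensor.

(*  With N = n.+1 variables in total,                                         *)
(*  Q = mps V n = V[[x_2, ..., x_N]] and S = mps V n.+1 = Q[[x_1]], so that   *)
(*  x_1 is fpsX : mps V n.+1, Q -> S is fpsC, and T = S[[t]] is               *)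
(*  fps (mps V n.+1), with t = fpsX.                                          *)

Section HomR.
Variables (V : idomainType) (n : nat) (R : comNzRingType).
Variables (M : ideal R) (I : ideal (mps V n)).
Variables (phi : {rmorphism quot I -> R}) (pi : {rmorphism mps V n.+1 -> mps V n}).

(* pi is a morphism of Q-algebras and maps x_1 to p. It is then surjective;   *)
(* when p generates the maximal ideal of V it is also continuous, and the     *)
(* only such morphism, as pi ((x_1)^k) is contained in p^k Q.                 *)
Definition is_eval_at_p (p : nat) : Prop :=
  (forall q : mps V n, pi (fpsC q) = q) /\ pi fpsX = p%:R.

Definition homR := quot (hom_ideal (ipreim pi I)).
HB.instance Definition _ := GRing.ComPzRing.on homR.

Definition T_to_homR : {rmorphism fps (mps V n.+1) -> homR} :=
  qpi (hom_ideal (ipreim pi I)).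

Definition homR_t : homR := T_to_homR fpsX.

Definition homR_mod_t := quot (igen [set homR_t]).
HB.instance Definition _ := GRing.ComPzRing.on homR_mod_t.

Definition V_to_homR_mod_t : {rmorphism V -> homR_mod_t} :=
  (qpi (igen [set homR_t]) \o T_to_homR \o @fpsC _ \o mpsC V n.+1)%FUN.

Definition gr_completion := completion (gr_plus (M := M)).
HB.instance Definition _ := GRing.ComPzRing.on gr_completion.

Definition V_to_R : {rmorphism V -> R} := (phi \o qpi I \o mpsC V n)%FUN.

Definition V_to_gr_completion (v : V) : gr_completion :=
  to_completion (gr_plus (M := M)) (gr0 M (V_to_R v)).

Definition Vt_to_homR : {rmorphism fps V -> homR} :=
  (T_to_homR \o fps_map (mpsC V n.+1))%FUN.

Definition homR_laurent := tensor Vt_to_homR (laurent_of_fps V).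
HB.instance Definition _ := GRing.ComPzRing.on homR_laurent.

Definition S_to_homR_laurent (f : mps V n.+1) : homR_laurent :=
  tensl Vt_to_homR (laurent_of_fps V) (T_to_homR (fpsC f)).

(* the extension of (p, x_1, ..., x_N) *)
Definition homR_laurent_ideal (p : nat) : ideal homR_laurent :=
  igen (S_to_homR_laurent @` ([set p%:R] `|` range (@mpsX V n.+1))).

Definition R_laurent := tensor V_to_R (laurentC V).
HB.instance Definition _ := GRing.ComPzRing.on R_laurent.

Definition R_laurent_ideal : ideal R_laurent :=
  igen (tensl V_to_R (laurentC V) @` M).

Definition homR_laurent_completion (p : nat) := completion (homR_laurent_ideal p).
HB.instance Definition _ p := GRing.ComPzRing.on (homR_laurent_completion p).

Definition R_laurent_completion := completion R_laurent_ideal.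
HB.instance Definition _ := GRing.ComPzRing.on R_laurent_completion.

Definition laurent_to_homR_laurent_completion (p : nat) (c : laurent V) :
    homR_laurent_completion p :=
  to_completion (homR_laurent_ideal p) (tensr Vt_to_homR (laurent_of_fps V) c).

Definition laurent_to_R_laurent_completion (c : laurent V) : R_laurent_completion :=
  to_completion R_laurent_ideal (tensr V_to_R (laurentC V) c).

End HomR.

(* Main.v *)
Require Import Defs.
From HB Require Import structures.
From mathcomp Require Import all_boot all_order all_algebra.
From mathcomp Require Import zify.
From mathcomp Require Import boolp classical_sets.

Set Implicit Arguments.
Unset Strict Implicit.
Unset Printing Implicit Defensive.
Import GRing.Theory.
Local Open Scope ring_scope.
Local Open Scope classical_set_scope.

(** Write S for V[[x_1, ..., x_N]], theta for the surjection from S to R that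
    sends x_1 to p, L for its kernel, H for the ideal hom(L) of T = S[[t]], and
    hpart d f for the component of degree d of a series f. Give S the
    filtration by degree: its d-th step hfil d consists of the series without
    terms of degree less than d, and it is the d-th power of (x_1, ..., x_N).
    Since p = theta x_1, the maximal ideal M of R is the image of
    (x_1, ..., x_N), and so M^d is the image of hfil d (M_presentation,
    iexp_presentation): the presence of x_1 turns the M-adic filtration of R,
    which sees p as an element of degree one, into a filtration by degree.

    Everything about H follows from a standard basis of L: finitely many f_j in
    L, of orders o_j, whose initial forms generate all initial forms of elements
    of L. It exists because S is noetherian (fps_noetherian). Since S is
    complete, an element of L of order w is then a combination of the f_j with
    coefficients of order at least w - o_j, found by successive approximation
    (standard_basis_lift); dividing by powers of t, hom(f) is a combination of
    the hom(f_j), and these generate H.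

    That t is regular on T / H says that a relation between the initial forms of
    the f_j lifts to a relation between the hom(f_j). The part of degree w of
    such a relation gives an element of L of order greater than w, which can be
    expanded again in the f_j with a gain of one power of t (syzygy_lift); the
    sum over all w converges (hom_ideal_t_regular).

    Setting t = 0 turns H into the ideal of initial forms of L
    (hom_ideal_mod_t). A series f maps to the sequence of the classes of
    theta (hpart d f) in M^d / M^(d+1), which is an arbitrary element of the
    completion of G; this element is zero if and only if every hpart d f is zero
    or an initial form of an element of L (gr_completion_presentation). Hence S
    modulo the initial ideal is the completion of G.

    Once t is inverted, hom(f) and psi(f) = f(x_1 t, ..., x_N t) generate the
    same ideal for every f in L, so psi induces a map from the tensor product of
    R and V((t)) to that of T / H and V((t)). It is an isomorphism modulo every power of the
    ideals at hand, its inverse being the evaluation of power series at the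
    elements x_i / t, which are nilpotent there (homR_laurent_eval); the
    completions are therefore isomorphic. *)

(** * Quotients, tensor products and completions *)

Arguments imul : simpl never.
Arguments igen : simpl never.

Lemma ideal_sum (A : comPzRingType) (I : ideal A) (K : Type) (r : seq K)
    (P : pred K) (F : K -> A) :
  (forall i, P i -> I (F i)) -> I (\sum_(i <- r | P i) F i).
Proof.
move=> h; apply: (big_ind I); [exact: ideal0|exact: idealD|exact: h].
Qed.

Lemma igen_lincomb (A : comPzRingType) (K : finType) (f : K -> A) x :
  igen (range f) x -> exists a : K -> A, x = \sum_j a j * f j.
Proof.
have Pi : is_ideal [set y | exists a : K -> A, y = \sum_j a j * f j].
  split=> [|y z [a ->] [b ->]|c y [a ->]].
  - by exists (fun=> 0); rewrite big1 // => j _; rewrite mul0r.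
  - exists (fun j => a j + b j); rewrite -big_split /=.
    by apply: eq_bigr => j _; rewrite mulrDl.
  - exists (fun j => c * a j); rewrite mulr_sumr.
    by apply: eq_bigr => j _; rewrite mulrA.
apply: (@igen_min _ _ (Ideal Pi)) => y [j _ <-] /=; exists (fun i => (i == j)%:R).
by rewrite (bigD1 j) //= eqxx mul1r big1 ?addr0 // => i /negPf->; rewrite mul0r.
Qed.

Lemma iexp_morph (A B : comPzRingType) (f : {rmorphism A -> B}) (X : set A)
    (J : set B) k a :
  (forall x, X x -> J (f x)) -> iexp X k a -> iexp J k (f a).
Proof.
move=> XJ; elim: k a => [|k IH] // a.
apply: (@igen_min _ _ (ipreim f (imul J (iexp J k)))) => _ [y Xy [z hz <-]] /=.
rewrite rmorphM; apply: igen_sub; exists (f y); first exact: XJ.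
by exists (f z) => //; apply: IH.
Qed.

Lemma iexp_igen (A : comPzRingType) (X : set A) k a :
  iexp (igen X) k a -> iexp X k a.
Proof.
elim: k a => [|k IH] // a; apply: igen_min => _ [y hy [z hz <-]].
rewrite -(mulrC z).
have Pi : is_ideal [set y | imul X (iexp X k) (z * y)].
  rewrite /mkset; split=> [|u v hu hv|c u hu].
  - by rewrite mulr0; apply: ideal0.
  - by rewrite mulrDr; apply: idealD.
  - by rewrite mulrCA; apply: idealM.
apply: (@igen_min _ _ (Ideal Pi) _ y hy) => u Xu /=; rewrite mulrC.
by apply: igen_sub; exists u => //; exists z => //; apply: IH.
Qed.

Lemma rmorphism_of (A B : pzRingType) (F : A -> B) :
  zmod_morphism F -> monoid_morphism F -> exists G : {rmorphism A -> B}, G =1 F.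
Proof.
move=> Fz Fm; pose mz := GRing.isZmodMorphism.Build A B F Fz.
pose mm := GRing.isMonoidMorphism.Build A B F Fm.
by pose G : {rmorphism A -> B} := HB.pack F mz mm; exists G.
Qed.

Lemma inj_surj_bijective (T U : Type) (f : T -> U) :
  injective f -> (forall y, exists x, f x = y) -> bijective f.
Proof.
move=> fi /choice[g gK]; exists g => // x; exact/fi/gK.
Qed.

Lemma rmorph_inj0 (A B : pzRingType) (f : {rmorphism A -> B}) :
  (forall x, f x = 0 -> x = 0) -> injective f.
Proof.
by move=> h x y e; apply/eqP; rewrite -subr_eq0; apply/eqP/h; rewrite rmorphB e subrr.
Qed.

Lemma rmorph_factor (A B C : pzRingType) (q : {rmorphism A -> B})
    (g : {rmorphism A -> C}) :
    (forall b, exists a, q a = b) -> (forall a, q a = 0 -> g a = 0) ->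
  exists F : {rmorphism B -> C}, forall a, F (q a) = g a.
Proof.
move=> qs qg; have [s sK] := choice qs.
have FE a : g (s (q a)) = g a.
  by apply/eqP; rewrite -subr_eq0 -rmorphB qg // rmorphB sK subrr.
have [||F FP] := @rmorphism_of B C (g \o s).
- by move=> x y; rewrite /= -[x]sK -[y]sK -rmorphB !FE rmorphB.
- split=> [|x y]; first by rewrite /= -(rmorph1 q) FE rmorph1.
  by rewrite /= -[x]sK -[y]sK -rmorphM !FE rmorphM.
by exists F => a; rewrite FP /= FE.
Qed.

Section QuotientLift.
Variables (A B : comPzRingType) (I : ideal A).

Lemma qpi_eq0 x : qpi I x = 0 <-> I x.
Proof. by rewrite -(rmorph0 (qpi I)) qpi_eq subr0. Qed.

Lemma quot_lift (g : {rmorphism A -> B}) : (forall a, I a -> g a = 0) ->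
  exists F : {rmorphism quot I -> B}, forall a, F (qpi I a) = g a.
Proof.
move=> gI; apply: rmorph_factor => [u|a /qpi_eq0/gI//].
by have [a ->] := qpi_surj u; exists a.
Qed.

Lemma quot_iso (g : {rmorphism A -> B}) :
    (forall a, I a <-> g a = 0) -> (forall b, exists a, g a = b) ->
  exists F : {rmorphism quot I -> B},
    bijective F /\ forall a, F (qpi I a) = g a.
Proof.
move=> gI gs; have [F FE] := quot_lift (fun a => proj1 (gI a)).
exists F; split=> //; apply: inj_surj_bijective.
  apply: rmorph_inj0 => u; have [a ->] := qpi_surj u.
  by rewrite FE => /gI/qpi_eq0.
by move=> b; have [a <-] := gs b; exists (qpi I a).
Qed.
End QuotientLift.

Section TensorLift.
Variables (C A B : comPzRingType) (f : {rmorphism C -> A}) (g : {rmorphism C -> B}).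

Lemma tensor_lift (D : comPzRingType) (u : {rmorphism A -> D})
    (v : {rmorphism B -> D}) : (forall c, u (f c) = v (g c)) ->
  exists F : {rmorphism tensor f g -> D},
    (forall a, F (tensl f g a) = u a) /\ (forall b, F (tensr f g b) = v b).
Proof.
move=> uv; pose W (s : seq (A * B)) := \sum_(x <- s) u x.1 * v x.2.
have W_eq s t : tens_eq f g s t -> W s = W t.
  elim=> {s t} //.
  - by move=> s t u' _ -> _ ->.
  - by move=> s s' t t' _ h1 _ h2; rewrite /W !big_cat -!/(W _) h1 h2.
  - by move=> s t; rewrite /W !big_cat /= addrC.
  - by move=> a a' b; rewrite /W !big_cons !big_nil /= !addr0 rmorphD mulrDl.
  - by move=> a b b'; rewrite /W !big_cons !big_nil /= !addr0 rmorphD mulrDr.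
  - move=> c a b; rewrite /W !big_cons !big_nil /= !addr0 !rmorphM uv.
    by rewrite mulrAC mulrA [LHS]mulrC mulrA.
  - by move=> b; rewrite /W big_cons big_nil /= rmorph0 mul0r addr0.
pose F (x : tensor f g) := W (repr x).
have FE s : F (tpi f g s) = W s by apply/W_eq/repr_tpi.
have [] := @rmorphism_of (tensor f g) D F.
- move=> x y; have [s ->] := tpi_surj x; have [t ->] := tpi_surj y.
  rewrite -[_ - _]/(tadd _ (topp _)) tpiN tpiD !FE /W big_cat /=; congr (_ + _).
  by rewrite /wopp big_map -sumrN; apply: eq_bigr => i _ /=; rewrite rmorphN mulNr.
- split=> [|x y].
    by rewrite -[1]/(tpi f g [:: (1, 1)]) FE /W big_cons big_nil /= !rmorph1 mulr1 addr0.
  have [s ->] := tpi_surj x; have [t ->] := tpi_surj y.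
  rewrite -[_ * _]/(tmul _ _) tpiM !FE /W big_allpairs_dep mulr_suml /=.
  apply: eq_bigr => i _; rewrite mulr_sumr; apply: eq_bigr => j _ /=.
  by rewrite !rmorphM mulrACA.
move=> G GE; exists G; split=> a; rewrite GE /tensl /tensr /tens FE /W;
  by rewrite big_cons big_nil /= rmorph1 ?mulr1 ?mul1r addr0.
Qed.

Lemma tensor_ind (P : tensor f g -> Prop) :
    P 0 -> (forall x y, P x -> P y -> P (x + y)) ->
    (forall a b, P (tensl f g a * tensr f g b)) -> forall x, P x.
Proof.
move=> P0 PD PM x; have [s ->] := tpi_surj x.
elim: s => [|[a b] s IH] //.
have -> : tpi f g ((a, b) :: s) = tensl f g a * tensr f g b + tpi f g s.
  rewrite -[_ + _]/(tadd (tmul _ _) _) /tensl /tensr /tens tpiM wmul1 /= tpiD.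
  by rewrite mulr1 mul1r.
exact: PD.
Qed.

Lemma tens_base c : tensl f g (f c) = tensr f g (g c).
Proof.
rewrite /tensl /tensr /tens -[f c]mulr1 -[g c]mulr1; apply/tpi_eq/tens_scal.
Qed.
End TensorLift.

(** The hypotheses say that f induces an injective map from B / J^k to A / I^k,
    and a surjective one. The inverse maps form the map of completions, whose
    values are found by choosing approximations in B. *)
Lemma completion_iso (A B : comPzRingType) (I : set A) (J : set B)
    (f : {rmorphism B -> A}) :
    (forall k b, iexp I k (f b) <-> iexp J k b) ->
    (forall k a, exists b, iexp I k (a - f b)) ->
  exists F : {rmorphism completion I -> completion J},
    bijective F /\ forall b, F (to_completion I (f b)) = to_completion J b.
Proof.
move=> fE fd.
have lift k a : exists b, qpi (iexp I k) a = qpi _ (f b).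
  by have [b hb] := fd k a; exists b; apply/qpi_eq.
have feq k b c : qpi (iexp I k) (f b) = qpi _ (f c) <-> qpi (iexp J k) b = qpi _ c.
  by rewrite !qpi_eq -rmorphB fE.
have Wdown (D : comPzRingType) (X : set D) k x y : qpi (iexp X k.+1) x = qpi _ y ->
    qpi (iexp X k) x = qpi _ y.
  by move=> /qpi_eq h; apply/qpi_eq/iexpW.
have Lift (u : completion I) : exists w : completion J, forall k b,
    cseq w k = qpi _ b <-> cseq u k = qpi _ (f b).
  have /choice[b bE] k : exists b, cseq u k = qpi _ (f b).
    by have [a [-> _]] := cseqP u k; apply: lift.
  have bP k : exists a,
      qpi (iexp J k) (b k) = qpi _ a /\ qpi (iexp J k.+1) (b k.+1) = qpi _ a.
    exists (b k.+1); split=> //; have [a [e1 e2]] := cseqP u k.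
    by apply/feq; rewrite -bE e1; apply/Wdown; rewrite -e2.
  by exists (@Completion _ J (fun k => qpi (iexp J k) (b k)) bP) => k c /=; rewrite bE feq.
have [F0 FP] := choice Lift.
have FE u w :
    (forall k, exists2 b, cseq w k = qpi _ b & cseq u k = qpi _ (f b)) -> F0 u = w.
  by move=> h; apply: cseq_inj => k; have [b -> hb] := h k; apply/FP.
have rep u k : exists2 b, cseq (F0 u) k = qpi _ b & cseq u k = qpi _ (f b).
  by have [a e] := qpi_surj (cseq (F0 u) k); exists a => //; apply/FP.
have [] := @rmorphism_of (completion I) (completion J) F0.
- move=> u v; apply: FE => k; have [b e1 e2] := rep u k; have [c e3 e4] := rep v k.
  exists (b - c); first by rewrite /= e1 e3 !rmorphB.
  by rewrite /= e2 e4 !rmorphB.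
- split=> [|u v]; apply: FE => k; first by exists 1; rewrite /= ?rmorph1.
  have [b e1 e2] := rep u k; have [c e3 e4] := rep v k.
  by exists (b * c); rewrite /= ?e1 ?e2 ?e3 ?e4 !rmorphM.
move=> F FE0; exists F; split; last first.
  by move=> b; rewrite FE0; apply: FE => k; exists b.
apply: inj_surj_bijective => [u v|w].
  rewrite !FE0 => e; apply: cseq_inj => k.
  by have [b e1 e2] := rep u k; rewrite e2; apply/esym/FP; rewrite -e.
have uP k : exists a, qpi (iexp I k) (f (repr (cseq w k))) = qpi _ a /\
    qpi (iexp I k.+1) (f (repr (cseq w k.+1))) = qpi _ a.
  have rE j : qpi _ (repr (cseq w j)) = cseq w j by rewrite /qpi reprK.
  have [c [e1 e2]] := cseqP w k.
  by exists (f c); split; apply/feq; rewrite rE.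
exists (@Completion _ I (fun k => qpi (iexp I k) (f (repr (cseq w k)))) uP).
rewrite FE0; apply: FE => k; exists (repr (cseq w k)) => //=.
by rewrite /qpi reprK.
Qed.

Lemma iexpX (A : comPzRingType) (X : set A) k x : X x -> iexp X k (x ^+ k).
Proof.
move=> Xx; elim: k => [|k IH] //; rewrite exprS; apply: igen_sub.
by exists x => //; exists (x ^+ k).
Qed.

Lemma iexp_image (A B : comPzRingType) (f : {rmorphism A -> B}) (X : set A) k b :
  iexp (f @` X) k b -> igen (f @` iexp X k) b.
Proof.
elim: k b => [|k IH] b.
  by rewrite -[b]mulr1 => _; apply: idealM; apply: igen_sub; exists 1; rewrite ?rmorph1.
apply: igen_min => _ [_ [x Xx <-] [z /IH hz <-]].
have PI : is_ideal [set z | igen (f @` iexp X k.+1) (f x * z)].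
  rewrite /mkset; split=> [|u v hu hv|c u hu].
  - by rewrite mulr0; apply: ideal0.
  - by rewrite mulrDr; apply: idealD.
  - by rewrite mulrCA; apply: idealM.
apply: (@igen_min _ _ (Ideal PI) _ z hz) => _ [a ha <-]; rewrite /mkset /= -rmorphM.
apply: igen_sub; exists (x * a) => //; apply: igen_sub.
by exists x => //; exists a.
Qed.

Lemma iexp_image0 (A B : comPzRingType) (f : {rmorphism A -> B}) (X : set A) k :
  (forall a, iexp X k a -> f a = 0) -> forall b, iexp (f @` X) k b -> b = 0.
Proof.
move=> f0 b /iexp_image; have PI : is_ideal [set 0 : B].
  by split=> // [x y -> ->|a x ->]; rewrite ?addr0 ?mulr0.
by apply: (@igen_min _ _ (Ideal PI)) => _ [a /f0 fa <-].
Qed.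

(** * Complete filtrations and noetherian power series rings *)

(** The steps of the filtration are ideals, so that products are continuous;
    cfil_sum is completeness, in terms of series instead of Cauchy sequences. *)
Record complete_filtration (A : comNzRingType) (Fil : nat -> set A) : Prop := {
  cfil_ideal : forall d, is_ideal (Fil d);
  cfil0 : forall x, Fil 0 x;
  cfilW : forall d x, Fil d.+1 x -> Fil d x;
  cfil_sep : forall x, (forall d, Fil d x) -> x = 0;
  cfil_sum : forall c : nat -> A, (forall d, Fil d (c d)) ->
    exists s, forall k, Fil k (s - \sum_(i < k) c i) }.

Section SuccessiveApproximation.
Variables (A : comNzRingType) (Fil : nat -> set A).
Hypothesis FilP : complete_filtration Fil.
Let FI d := Ideal (cfil_ideal FilP d).

Lemma cfil_le d e x : (d <= e)%N -> Fil e x -> Fil d x.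
Proof.
move=> /subnK <-; elim: (e - d)%N => [|k IH] // h; exact/IH/(cfilW FilP).
Qed.

Lemma cfil_sum_off (o : nat) (c : nat -> A) : (forall d, Fil (d - o) (c d)) ->
  exists s, forall k, Fil (k - o) (s - \sum_(i < k) c i).
Proof.
move=> hc; have [|s sP] := cfil_sum FilP (c := fun d => c (d + o)%N).
  by move=> d; have := hc (d + o)%N; rewrite addnK.
exists (s + \sum_(i < o) c i) => k; case: (leqP k o) => ko.
  by move: ko; rewrite -subn_eq0 => /eqP->; apply: cfil0 FilP _.
have -> : \sum_(i < k) c i = \sum_(i < o) c i + \sum_(i < k - o) c (i + o)%N.
  rewrite -(big_mkord xpredT c) (big_cat_nat _ (n := o)) ?(ltnW ko) //=.
  by rewrite -[X in \sum_(X <= i < k) _]add0n big_addn !big_mkord.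
by rewrite opprD addrA addrK; apply: sP.
Qed.

(** The corrections c found at the successive steps tend to zero and sum to the
    coefficients a, while the remainder lies in every step of the filtration.
    The offset off j stands for the order of f j: the order of a j has to be
    controlled as sharply as that of c j, since homogenizing a combination of
    the f j needs it. *)
Lemma successive_approximation (K : finType) (f : K -> A) (off : K -> nat) (o : nat)
    (P : nat -> set A) :
    (forall w g, P w g -> Fil (w - o) g) ->
    (forall w g, P w g -> exists2 c : K -> A,
      (forall j, Fil (w - off j) (c j)) & P w.+1 (g - \sum_j c j * f j)) ->
  forall w g, P w g -> exists2 a : K -> A,
    (forall j, Fil (w - off j) (a j)) & g = \sum_j a j * f j.
Proof.
move=> PF Pstep w g Pg.
have /choice[c cP] (wg : nat * A) : exists c : K -> A, P wg.1 wg.2 ->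
    (forall j, Fil (wg.1 - off j) (c j)) /\ P wg.1.+1 (wg.2 - \sum_j c j * f j).
  case: (pselect (P wg.1 wg.2)) => [/Pstep[c h1 h2]|h]; first by exists c.
  by exists (fun=> 0).
pose gs := fix gs m := if m is l.+1 then
  gs l - \sum_j c ((w + l)%N, gs l) j * f j else g.
pose cs m := c ((w + m)%N, gs m).
have Pgs m : P (w + m)%N (gs m).
  by elim: m => [|m IH] /=; rewrite ?addn0 // addnS; apply: (cP (_, _) _).2.
have csF m j : Fil (w + m - off j) (cs m j) by apply: (cP (_, _) (Pgs m)).1.
have /choice[a aP] j : exists s, forall k, Fil (k - off j) (s - \sum_(i < k) cs i j).
  apply: (@cfil_sum_off _ (fun m => cs m j)) => d; refine (cfil_le _ (csF d j)).
  by apply: leq_sub2r; apply: leq_addl.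
exists a => [j|].
  rewrite -(subrK (\sum_(i < w) cs i j) (a j)).
  apply: (@idealD _ (FI (w - off j))); first exact: aP.
  apply: (@ideal_sum _ (FI (w - off j))) => i _.
  by refine (cfil_le _ (csF i j)); apply: leq_sub2r; apply: leq_addr.
apply/eqP; rewrite -subr_eq0; apply/eqP; apply: (cfil_sep FilP) => d.
(* After m = d + O steps, both the remainder and the tails of the coefficients *)
(* lie in Fil d.                                                               *)
pose O := (o + \sum_j off j)%N; pose m := (d + O)%N.
have -> : g - \sum_j a j * f j =
    gs m - \sum_j (a j - \sum_(i < m) cs i j) * f j.
  elim: m => [|m IH] /=.
    by congr (_ - _); apply: eq_bigr => j _; rewrite big_ord0 subr0.
  rewrite {}IH -addrA -opprD; congr (_ - _); rewrite -big_split /=.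
  apply: eq_bigr => j _.
  by rewrite -mulrDl big_ord_recr /= opprD [in RHS]addrC addrA subrK.
apply: (@idealB _ (FI d)).
  by refine (cfil_le _ (PF _ _ (Pgs m))); rewrite /m /O; lia.
apply: (@ideal_sum _ (FI d)) => j _; rewrite mulrC; apply: (@idealM _ (FI d)).
refine (cfil_le _ (aP j m)); rewrite /m /O (bigD1 j) //=; lia.
Qed.
End SuccessiveApproximation.

Section FpsFiltration.
Variable A : comNzRingType.
Implicit Types f g : fps A.

Lemma fcoef_sum (K : Type) (r : seq K) (P : pred K) (F : K -> fps A) k :
  fcoef (\sum_(i <- r | P i) F i) k = \sum_(i <- r | P i) fcoef (F i) k.
Proof. by apply: (big_morph (fun f => fcoef f k)) => //=; rewrite if_same. Qed.

Lemma fcoefN f k : fcoef (- f) k = - fcoef f k. Proof. by []. Qed.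
Lemma fcoefB f g k : fcoef (f - g) k = fcoef f k - fcoef g k. Proof. by []. Qed.
Lemma fcoef0 k : fcoef (0 : fps A) k = 0. Proof. by rewrite /= if_same. Qed.

Lemma fcoef_XM f k : fcoef (fpsX * f) k = if k is l.+1 then fcoef f l else 0.
Proof.
rewrite fcoefM big_ord_recl /= mul0r add0r; case: k => [|k]; first by rewrite big_ord0.
rewrite big_ord_recl /= mul1r big1 ?addr0 => [|i _]; last exact: mul0r.
by rewrite subSS subn0.
Qed.

Lemma fcoef_XnM n f k :
  fcoef (fpsX ^+ n * f) k = if (n <= k)%N then fcoef f (k - n) else 0.
Proof.
elim: n k => [|n IH] k; first by rewrite expr0 mul1r subn0.
by rewrite exprS -mulrA fcoef_XM; case: k => [|k] //; rewrite IH ltnS subSS.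
Qed.

Lemma fcoef_CM a f k : fcoef (fpsC a * f) k = a * fcoef f k.
Proof.
rewrite fcoefM big_ord_recl /= subn0 big1 ?addr0 // => i _; exact: mul0r.
Qed.

Lemma fpsX_cancel n f g : fpsX ^+ n * f = fpsX ^+ n * g -> f = g.
Proof.
move=> e; apply: fps_ext => k; have := congr1 (fun h => fcoef h (k + n)) e.
by rewrite !fcoef_XnM leq_addl addnK.
Qed.

Definition xadic d : set (fps A) := [set f | forall k, (k < d)%N -> fcoef f k = 0].

Lemma xadic_ideal d : is_ideal (xadic d).
Proof.
split=> [k _|f g hf hg k kd|a f hf k kd]; first exact: fcoef0.
- by rewrite fcoefD hf // hg // addr0.
- rewrite fcoefM big1 // => i _; rewrite hf ?mulr0 //.
  exact: leq_ltn_trans (leq_subr _ _) kd.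
Qed.

Lemma xadic_complete : complete_filtration xadic.
Proof.
split=> //; first exact: xadic_ideal.
- by move=> d f hf k kd; apply: hf; apply: ltnW.
- by move=> f hf; apply: fps_ext => k; rewrite fcoef0; apply: (hf k.+1).
move=> c hc; exists (Fps (fun k => \sum_(i < k.+1) fcoef (c i) k)) => d k kd.
rewrite fcoefB fcoef_sum /= -(big_mkord xpredT (fun i => fcoef (c i) k)).
rewrite -(big_mkord xpredT (fun i => fcoef (c i) k)).
rewrite [X in _ - X](big_cat_nat _ (n := k.+1)) //=.
rewrite opprD addrA subrr sub0r big_nat big1 ?oppr0 // => i /andP[ki _].
exact: hc.
Qed.
End FpsFiltration.

Definition finitely_generated (A : comPzRingType) (I : set A) : Prop :=
  exists (K : finType) (f : K -> A),
    (forall j, I (f j)) /\ forall x, I x -> exists a : K -> A, x = \sum_j a j * f j.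

Definition noetherian (A : comPzRingType) : Prop :=
  forall I : ideal A, finitely_generated I.

(** The elements of a finite set of generators involve only finitely many
    elements of any other generating set. *)
Lemma noetherian_igen (A : comPzRingType) (X : set A) : noetherian A ->
  exists (K : finType) (f : K -> A),
    (forall j, X (f j)) /\ forall x, igen X x -> exists a : K -> A, x = \sum_j a j * f j.
Proof.
move=> An; pose Y : set A := [set x | exists (K : finType) (f : K -> A),
  (forall j, X (f j)) /\ exists a : K -> A, x = \sum_j a j * f j].
have YI : is_ideal Y.
  split=> [|x y [K [f [Xf [a ->]]]] [K' [f' [Xf' [a' ->]]]]|c x [K [f [Xf [a ->]]]]].
  - by exists void, (fun=> 0); split=> [[]|]; exists (fun=> 0); rewrite big1.
  - exists (K + K')%type, (fun j => match j with inl i => f i | inr i => f' i end).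
    split=> [[]//|]; exists (fun j => match j with inl i => a i | inr i => a' i end).
    by rewrite big_sumType.
  - exists K, f; split=> //; exists (fun j => c * a j); rewrite mulr_sumr.
    by apply: eq_bigr => j _; rewrite mulrA.
have XY x : igen X x -> Y x.
  apply: (@igen_min _ _ (Ideal YI)) => y Xy; exists unit, (fun=> y); split=> //.
  by exists (fun=> 1); rewrite big_const card_unit /= mul1r addr0.
have [K [f [fX fg]]] := An (igen X).
have /choice[E EP] j : exists E : {K' : finType & ((K' -> A) * (K' -> A))%type},
    (forall i, X ((projT2 E).1 i)) /\
    f j = \sum_i (projT2 E).2 i * (projT2 E).1 i.
  by have [K' [f' [h [b hb]]]] := XY _ (fX j); exists (existT _ K' (f', b)).
exists {j : K & projT1 (E j)}, (fun s => (projT2 (E (tag s))).1 (tagged s)); split.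
  by move=> s; apply: (EP _).1.
move=> x /fg[a ->]; exists (fun s => a (tag s) * (projT2 (E (tag s))).2 (tagged s)).
transitivity (\sum_j \sum_i a j * (projT2 (E j)).2 i * (projT2 (E j)).1 i).
  apply: eq_bigr => j _; rewrite (EP j).2 mulr_sumr; apply: eq_bigr => i _.
  by rewrite mulrA.
by rewrite sig_big_dep.
Qed.

Lemma noetherian_chain (A : comPzRingType) (I : nat -> ideal A) : noetherian A ->
    (forall i x, I i x -> I i.+1 x) ->
  exists r, forall i x, I i x -> I r x.
Proof.
move=> An Iinc.
have Imon i j x : (i <= j)%N -> I i x -> I j x.
  by move=> /subnK<-; elim: (j - i)%N => [|k IH] // h; apply/Iinc/IH.
have UI : is_ideal [set x | exists i, I i x].
  split=> [|x y [i hx] [j hy]|c x [i hx]].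
  - by exists 0%N; apply: ideal0.
  - by exists (maxn i j); apply: idealD; [apply: Imon hx|apply: Imon hy];
      rewrite ?leq_maxl ?leq_maxr.
  - by exists i; apply: idealM.
have [K [f [fU fg]]] := An (Ideal UI).
have {fU} /choice[r rP] : forall j, exists i, I i (f j) by [].
exists (\max_j r j)%N => i x h; have [|a ->] := fg x; first by exists i.
apply: ideal_sum => j _; apply: idealM; apply: Imon (rP j).
exact: leq_bigmax.
Qed.

(** Hilbert's argument, with lowest instead of highest coefficients. The ideals
    lead d of the coefficients of x^d in elements of J of order at least d
    increase to lead r. Above order r, a series in J is expanded in lifts of
    generators of lead r by successive approximation; the orders below r are
    treated by descending induction. *)
Lemma fps_noetherian (A : comNzRingType) : noetherian A -> noetherian (fps A).
Proof.
move=> An J; pose JX d : set (fps A) := [set f | J f /\ xadic d f].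
pose lead d : set A := [set a | exists2 f, JX d f & fcoef f d = a].
have JXI d : is_ideal (JX d).
  split=> [|f g [h1 h2] [h3 h4]|c f [h1 h2]]; split.
  - exact: ideal0.
  - exact: (@ideal0 _ (Ideal (@xadic_ideal A d))).
  - exact: idealD.
  - exact: (@idealD _ (Ideal (@xadic_ideal A d))).
  - exact: idealM.
  - exact: (@idealM _ (Ideal (@xadic_ideal A d))).
have leadI d : is_ideal (lead d).
  split=> [|a b [f hf <-] [g hg <-]|c a [f hf <-]].
  - by exists 0; [apply: (@ideal0 _ (Ideal (JXI d)))|apply: fcoef0].
  - by exists (f + g); [apply: (@idealD _ (Ideal (JXI d)))|].
  - by exists (fpsC c * f); [apply: (@idealM _ (Ideal (JXI d)))|apply: fcoef_CM].
have JXshift d k f : JX d f -> JX (k + d)%N (fpsX ^+ k * f).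
  move=> [h1 h2]; split; first exact: idealM.
  move=> i ikd; rewrite fcoef_XnM; case: leqP => // ki; apply: h2; lia.
have [r rP] : exists r, forall d a, lead d a -> lead r a.
  apply: (@noetherian_chain A (fun d => Ideal (leadI d))) => // d a [f hf <-].
  exists (fpsX ^+ 1 * f); first exact: (JXshift d 1%N).
  by rewrite fcoef_XnM /= subSS subn0.
have lift d : exists (K : finType) (f : K -> fps A), (forall j, JX d (f j)) /\
    forall a, lead d a -> exists c : K -> A, a = \sum_j c j * fcoef (f j) d.
  have [K [a [al ag]]] := An (Ideal (leadI d)).
  have /choice[f fP] j : exists f, JX d f /\ fcoef f d = a j.
    by have [f h1 h2] := al j; exists f.
  exists K, f; split=> [j|b /ag[c ->]]; first exact: (fP j).1.
  by exists c; apply: eq_bigr => j _; rewrite (fP j).2.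
(* JX (r - k) is the part of J of order at least r - k, and JX 0 is J. *)
suff main k : (k <= r)%N -> finitely_generated (JX (r - k)%N).
  have [K [f [fJ fg]]] := main r (leqnn r); rewrite subnn in fJ fg.
  by exists K, f; split=> [j|x hx]; [apply: (fJ j).1|apply: fg].
elim: k => [_|k IH kr].
  rewrite subn0; have [K [f [fJ fg]]] := lift r; exists K, f; split=> // x hx.
  pose P w : set (fps A) := JX (r + w)%N.
  have [|||a _ ->] := @successive_approximation _ _ (xadic_complete A) K f (fun=> 0%N)
    0%N P _ _ 0%N x.
  - by move=> w g [_ hg]; rewrite subn0; apply: (cfil_le (xadic_complete A) (leq_addl r w) hg).
  - move=> w g hg; have [|c cE] := fg (fcoef g (r + w)).
      by apply: (rP (r + w)%N); exists g.
    exists (fun j => fpsX ^+ w * fpsC (c j)) => [j|].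
      by move=> i; rewrite subn0 => iw; rewrite fcoef_XnM leqNgt iw.
    have hS : JX (r + w)%N (\sum_j fpsX ^+ w * fpsC (c j) * f j).
      apply: (@ideal_sum _ (Ideal (JXI _))) => j _; rewrite mulrAC mulrC.
      by apply: (@idealM _ (Ideal (JXI _))); rewrite addnC; apply: JXshift.
    have [h1 h2] := @idealB _ (Ideal (JXI _)) _ _ hg hS.
    split=> // i; rewrite addnS ltnS leq_eqVlt => /orP[/eqP->|/h2//].
    rewrite fcoefB fcoef_sum cE; apply/eqP; rewrite subr_eq0; apply/eqP.
    by apply: eq_bigr => j _; rewrite -mulrA fcoef_XnM leq_addl addnK fcoef_CM.
  - by rewrite /P addn0.
  - by exists a.
have [K [f [fJ fg]]] := IH (ltnW kr).
have [K' [f' [fJ' fg']]] := lift (r - k.+1)%N.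
have e : (r - k = (r - k.+1).+1)%N by lia.
exists (K' + K)%type, (fun j => match j with inl i => f' i | inr i => f i end).
split=> [[j|j]|x hx]; first exact: fJ'.
  by split; [apply: (fJ j).1|refine (cfil_le (xadic_complete A) _ (fJ j).2); lia].
have [|c cE] := fg' (fcoef x (r - k.+1)); first by exists x.
have [|a aE] := fg (x - \sum_j fpsC (c j) * f' j).
  have hS : JX (r - k.+1)%N (\sum_j fpsC (c j) * f' j).
    apply: (@ideal_sum _ (Ideal (JXI _))) => j _.
    by apply: (@idealM _ (Ideal (JXI _))); apply: fJ'.
  have [h1 h2] := @idealB _ (Ideal (JXI _)) _ _ hx hS.
  split=> // i; rewrite e ltnS leq_eqVlt => /orP[/eqP->|/h2//].
  rewrite fcoefB fcoef_sum cE; apply/eqP; rewrite subr_eq0; apply/eqP.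
  by apply: eq_bigr => j _; rewrite fcoef_CM.
exists (fun j => match j with inl i => fpsC (c i) | inr i => a i end).
by rewrite big_sumType /= -aE addrC subrK.
Qed.

Lemma mps_noetherian (V : comNzRingType) n : noetherian V -> noetherian (mps V n).
Proof. by move=> Vn; elim: n => [|n IH] //=; apply: fps_noetherian. Qed.

(** * Homogeneous components of power series *)

Lemma fps_decomp (A : comNzRingType) k (f : fps A) :
  exists g, f = \sum_(j < k) fpsX ^+ j * fpsC (fcoef f j) + fpsX ^+ k * g.
Proof.
exists (Fps (fun i => fcoef f (i + k))); apply: fps_ext => i.
rewrite fcoefD fcoef_sum fcoef_XnM.
under eq_bigr do rewrite fcoef_XnM /=.
case: leqP => [ki|ik] /=.
  rewrite subnK // big1 ?add0r // => j _; case: leqP => // ji.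
  by rewrite subn_eq0 leqNgt (leq_trans (ltn_ord j) ki).
rewrite addr0 (bigD1 (Ordinal ik)) //= leqnn subnn eqxx big1 ?addr0 // => j ji.
case: leqP => // ji'; case: eqP => // /eqP; rewrite subn_eq0 => ij.
by case/eqP: ji; apply: val_inj => /=; apply/eqP; rewrite eqn_leq ji' ij.
Qed.

Section Homogeneous.
Variable V : comNzRingType.

Lemma hpart_ext n (f g : mps V n) : (forall d, hpart d f = hpart d g) -> f = g.
Proof.
elim: n f g => [|n IH] f g h; first exact: (h 0%N).
apply: fps_ext => j; apply: IH => d.
by have := congr1 (fun u => fcoef u j) (h (d + j)%N); rewrite /= leq_addl addnK.
Qed.

Lemma hpart_hpart n d e (f : mps V n) :
  hpart d (hpart e f) = if d == e then hpart d f else 0.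
Proof.
elim: n d e f => [|n IH] d e f /=.
  by case: d e => [|d] [|e] //=; case: eqP.
case: eqP => [->|de]; apply: fps_ext => j /=; case: leqP => // jd.
  by rewrite IH eqxx.
  case: leqP => je; last by rewrite raddf0 if_same.
by rewrite IH; case: eqP => [|_]; [lia|rewrite if_same].
by rewrite if_same.
Qed.

(** A series is the family of its homogeneous components: assemble F takes the
    component of degree d from F d. In the recursion, the coefficient of the
    j-th power of the outermost variable has degree d - j, whence the shift. *)
Fixpoint assemble n : (nat -> mps V n) -> mps V n :=
  match n return (nat -> mps V n) -> mps V n with
  | 0 => fun F => F 0%N
  | k.+1 => fun F => Fps (fun j => assemble (fun d => fcoef (F (d + j)%N) j))
  end.

Lemma hpart_assemble n d (F : nat -> mps V n) :
  hpart d (assemble F) = hpart d (F d).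
Proof.
elim: n d F => [|n IH] d F /=; first by case: eqP => [->|].
by apply: fps_ext => j /=; case: leqP => // jd; rewrite IH subnK.
Qed.

Definition hfil n d : set (mps V n) := [set f | forall e, (e < d)%N -> hpart e f = 0].

Lemma hfilM n a b (f g : mps V n) : hfil a f -> hfil b g -> hfil (a + b) (f * g).
Proof.
move=> hf hg e eab; rewrite hpartM big1 // => i _.
case: (ltnP i a) => ia; first by rewrite hf ?mul0r.
by rewrite hg ?mulr0 //; have := ltn_ord i; lia.
Qed.

Lemma hfil_ideal n d : is_ideal (@hfil n d).
Proof.
split=> [e _|f g hf hg e ed|a f hf]; first exact: raddf0.
- by rewrite raddfD /= hf // hg // addr0.
- by rewrite -[d]add0n; apply: hfilM.
Qed.

Lemma hfil_complete n : complete_filtration (@hfil n).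
Proof.
split=> //; first exact: hfil_ideal.
- by move=> d f hf e ed; apply/hf/ltnW.
- by move=> f hf; apply: hpart_ext => d; rewrite raddf0; apply: (hf d.+1).
move=> c hc; exists (assemble (fun d => \sum_(i < d.+1) c i)) => d e ed.
rewrite raddfB /= hpart_assemble -!(big_mkord xpredT c).
rewrite [X in _ - hpart _ X](big_cat_nat _ (n := e.+1)) //= raddfD /= opprD addrA.
rewrite subrr sub0r raddf_sum big_nat big1 ?oppr0 // => i /andP[ei _].
exact: hc.
Qed.

Lemma hfil_le n d e (f : mps V n) : (d <= e)%N -> hfil e f -> hfil d f.
Proof. exact: (cfil_le (hfil_complete n)). Qed.

Lemma hpart_hfil n d (f : mps V n) : hfil d (hpart d f).
Proof. by move=> e ed; rewrite hpart_hpart ltn_eqF. Qed.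

Lemma hfil_subhpart n d (f : mps V n) : hfil d f -> hfil d.+1 (f - hpart d f).
Proof.
move=> hf e; rewrite ltnS raddfB /= hpart_hpart leq_eqVlt => /orP[/eqP->|ed].
  by rewrite eqxx subrr.
by rewrite ltn_eqF // hf // subrr.
Qed.

Lemma hpart_hpartM n a d (f g : mps V n) :
  hpart d (hpart a f * g) = if (a <= d)%N then hpart a f * hpart (d - a) g else 0.
Proof.
rewrite hpartM; case: leqP => [ad|da].
  have ad' : (a < d.+1)%N by [].
  rewrite (bigD1 (Ordinal ad')) //= hpart_hpart eqxx big1 ?addr0 // => i ia.
  by rewrite hpart_hpart -[_ == a]/(i == Ordinal ad') (negPf ia) mul0r.
rewrite big1 // => i _; rewrite hpart_hpart ltn_eqF ?mul0r //.
by rewrite (leq_trans (ltn_ord i)).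
Qed.

Lemma hpart_mulhpart n a d (f g : mps V n) :
  hpart d (g * hpart a f) = if (a <= d)%N then hpart (d - a) g * hpart a f else 0.
Proof. by rewrite mulrC hpart_hpartM mulrC. Qed.

Lemma xideal_fpsC n (f : mps V n) : xideal V n f -> xideal V n.+1 (fpsC f).
Proof.
apply: (@igen_min _ _ (ipreim (@fpsC _) (xideal V n.+1))) => _ [i _ <-] /=.
by apply: igen_sub; exists (lift ord0 i) => //=; rewrite liftK.
Qed.

Lemma fpsX_xideal n j : iexp (xideal V n.+1) j (fpsX ^+ j).
Proof.
elim: j => [|j IHj] //; rewrite exprS; apply: igen_sub; exists fpsX.
  by apply: igen_sub; exists ord0 => //=; rewrite unlift_none.
by exists (fpsX ^+ j).
Qed.

Lemma mpsX_hfil n (i : 'I_n) : hfil 1 (mpsX V i).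
Proof. by case=> // _; rewrite hpart_mpsX. Qed.

(** Products of k variables have order at least k by hfilM. Conversely, a series
    without terms of degree less than k is cut before the k-th power of the outermost variable; the
    coefficient of the j-th power then has order at least k - j. *)
Lemma iexp_xideal n k (f : mps V n) : iexp (xideal V n) k f <-> hfil k f.
Proof.
split.
  elim: k f => [|k IH] f //; apply: (@igen_min _ _ (Ideal (@hfil_ideal n k.+1))).
  move=> _ [y hy [z hz <-]]; rewrite -add1n; apply: hfilM; last exact: IH.
  by apply: (@igen_min _ _ (Ideal (@hfil_ideal n 1)) _ y hy) => _ [i _ <-]; apply: mpsX_hfil.
elim: n k f => [|n IH] k f hf.
  case: k hf => [|k] hf //; rewrite [f](hf 0%N) //; exact: ideal0.
have [g ->] := fps_decomp k f; apply: idealD; last first.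
  by rewrite mulrC; apply: idealM; apply: fpsX_xideal.
apply: ideal_sum => j _; have jk := ltnW (ltn_ord j).
have := @iexpM _ (xideal V n.+1) j (k - j)%N (fpsX ^+ j) (fpsC (fcoef f j)).
rewrite subnKC //; apply; [exact: fpsX_xideal|apply: iexp_morph (@xideal_fpsC n) _].
apply: IH => e ejk; have ekj : (e + j < k)%N by lia.
by have := congr1 (fun u => fcoef u j) (hf _ ekj); rewrite fcoef0 /= leq_addl addnK.
Qed.

Lemma hpart0_const n (f : mps V n) : exists v, hpart 0 f = mpsC V n v.
Proof.
elim: n f => [|n IH] f; first by exists f.
have [v vE] := IH (fcoef f 0); exists v; apply: fps_ext => -[|j] //=.
Qed.

(** The equation g * f = 1 is solved degree by degree. *)
Lemma mps_unit n (f : mps V n) : hpart 0 f = 1 -> exists g, g * f = 1.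
Proof.
move=> f1; have [|||a _ /esym] := @successive_approximation _ _ (hfil_complete n)
  unit (fun=> f) (fun=> 0%N) 0%N (@hfil n) _ _ 0%N 1.
- by move=> w g; rewrite subn0.
- move=> w g hg; exists (fun=> hpart w g); first by rewrite subn0 => _; apply: hpart_hfil.
  rewrite big_const card_unit /= addr0 => e; rewrite ltnS leq_eqVlt raddfB /=.
  rewrite hpart_hpartM => /orP[/eqP->|ew].
    by rewrite leqnn subnn f1 mulr1 subrr.
  by rewrite leqNgt ew hg // subrr.
- by [].
by rewrite (bigD1 tt) //= big1 ?addr0 => [h|[] //]; exists (a tt).
Qed.

End Homogeneous.

(** * Evaluation of power series at nilpotent elements *)

Lemma rmorph_inv (A B : pzRingType) (f : {rmorphism A -> B}) : bijective f ->
  exists g : {rmorphism B -> A}, cancel f g /\ cancel g f.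
Proof.
move=> [g fK gK]; have [||h hE] := @rmorphism_of B A g.
- by move=> x y; apply: (can_inj fK); rewrite rmorphB !gK.
- split=> [|x y]; apply: (can_inj fK); rewrite ?gK ?rmorph1 //.
  by rewrite rmorphM !gK.
by exists h; split=> x; rewrite hE.
Qed.

Section Evaluation.
Variables (C : comPzRingType).

(** Only the first k coefficients matter, so that no topology is needed on C. *)
Lemma fps_eval (A : comNzRingType) (e : {rmorphism A -> C}) (c : C) k :
  c ^+ k = 0 ->
  exists E : {rmorphism fps A -> C}, (forall a, E (fpsC a) = e a) /\ E fpsX = c.
Proof.
move=> ck0; pose E (f : fps A) := \sum_(j < k) e (fcoef f j) * c ^+ j.
have ED f g : E (f + g) = E f + E g.
  rewrite /E -big_split; apply: eq_bigr => j _ /=.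
  by rewrite rmorphD mulrDl.
have EN f : E (- f) = - E f.
  by rewrite /E -sumrN; apply: eq_bigr => j _; rewrite fcoefN rmorphN mulNr.
have E0 : E 0 = 0 by rewrite /E big1 // => j _; rewrite fcoef0 rmorph0 mul0r.
have EX f : E (fpsX * f) = c * E f.
  rewrite /E; clear ED EN E0 E; case: k ck0 => [|k] ck0; first by rewrite !big_ord0 mulr0.
  under eq_bigr do rewrite fcoef_XM.
  rewrite big_ord_recl /= rmorph0 mul0r add0r big_ord_recr mulrDr /=.
  rewrite mulrCA -exprS ck0 mulr0 addr0 mulr_sumr.
  by apply: eq_bigr => j _; rewrite mulrCA -exprS.
have EXn n f : E (fpsX ^+ n * f) = c ^+ n * E f.
  by elim: n => [|n IH]; rewrite ?mul1r // !exprS -!mulrA EX IH.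
have EC a f : E (fpsC a * f) = e a * E f.
  by rewrite /E mulr_sumr; apply: eq_bigr => j _; rewrite fcoef_CM rmorphM mulrA.
have E1 : E 1 = 1.
  rewrite /E; clear ED EN E0 EX EXn EC E; case: k ck0 => [|k] ck0.
    by rewrite big_ord0 -ck0 expr0.
  by rewrite big_ord_recl /= rmorph1 mulr1 big1 ?addr0 // => j _; rewrite rmorph0 mul0r.
have EM f g : E (f * g) = E f * E g.
  have [h ->] := fps_decomp k f; rewrite !mulrDl !ED mulrDl; congr (_ + _); last first.
    by rewrite -mulrA !EXn ck0 !mul0r.
  have Esum (F : 'I_k -> fps A) : E (\sum_j F j) = \sum_j E (F j).
    by apply: (big_morph E).
  rewrite mulr_suml !Esum mulr_suml; apply: eq_bigr => j _.
  by rewrite -mulrA EXn EC EXn -[fpsC _]mulr1 EC E1 mulr1 mulrA.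
have [||F FE] := @rmorphism_of (fps A) C E; first by move=> f g; rewrite ED EN.
  by split.
exists F; split=> [a|]; first by rewrite FE -[fpsC a]mulr1 EC E1 mulr1.
by rewrite FE -[fpsX]mulr1 EX E1 mulr1.
Qed.

Lemma mps_eval (W : comNzRingType) n (e : {rmorphism W -> C}) (c : 'I_n -> C) k :
    (forall i, c i ^+ k = 0) ->
  exists E : {rmorphism mps W n -> C},
    (forall v, E (mpsC W n v) = e v) /\ (forall i, E (mpsX W i) = c i).
Proof.
elim: n c => [|n IH] c c0; first by exists e; split=> // -[].
have [//|E [EC EX]] := IH (fun i => c (lift ord0 i)).
have [F [FC FX]] := fps_eval E (c0 ord0).
exists F; split=> [v|i]; first by rewrite /= FC EC.
by rewrite /=; case: unliftP => [j ->|->] //; rewrite FC EX.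
Qed.
End Evaluation.

(** This is how continuous ring morphisms are determined by their values at the
    constants and at the variables. *)
Lemma mps_dense (W : comNzRingType) n k (D : mps W n -> Prop) :
    (forall v, D (mpsC W n v)) -> (forall i, D (mpsX W i)) ->
    (forall f g, D f -> D g -> D (f + g)) -> (forall f g, D f -> D g -> D (f * g)) ->
    (forall f, iexp (xideal W n) k f -> D f) ->
  forall f, D f.
Proof.
elim: n D => [|n IH] D DC DX DD DM Dk f; first exact: DC.
have DXn j : D (fpsX ^+ j).
  elim: j => [|j IHj].
    by have := DC 1; rewrite rmorph1.
  rewrite exprS; apply: DM => //; have := DX ord0.
  by rewrite /= unlift_none.
have [g ->] := fps_decomp k f; apply: (DD); last first.
  apply: (Dk); rewrite mulrC; apply: idealM.
  exact: fpsX_xideal.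
have D0 : D 0 by have := DC 0; rewrite rmorph0.
apply: (big_ind D); [exact: D0|exact: DD|] => j _; apply: (DM); first exact: DXn.
apply: (IH (fun h : mps W n => D (fpsC h))) => [v|i|h h'|h h'|h hh].
- exact: DC.
- by have := DX (lift ord0 i); rewrite /= liftK.
- by move=> h1 h2; rewrite rmorphD; apply: DD.
- by move=> h1 h2; rewrite rmorphM; apply: DM.
- by apply: Dk; apply: iexp_morph hh => x; apply: xideal_fpsC.
Qed.

Section Transpose.
Variable A : comNzRingType.

Definition transpose (f : fps (fps A)) : fps (fps A) :=
  Fps (fun i => Fps (fun j => fcoef (fcoef f j) i)).

Fact transpose_zmod_morphism : zmod_morphism transpose.
Proof. by move=> f g; apply: fps_ext => i; apply: fps_ext. Qed.
Fact transpose_monoid_morphism : monoid_morphism transpose.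
Proof.
split=> [|f g].
  by apply: fps_ext => -[|i]; apply: fps_ext => -[|j].
apply: fps_ext => i; apply: fps_ext => j; rewrite fcoefM fcoef_sum /= fcoef_sum.
by rewrite exchange_big.
Qed.
HB.instance Definition _ :=
  GRing.isZmodMorphism.Build _ _ transpose transpose_zmod_morphism.
HB.instance Definition _ :=
  GRing.isMonoidMorphism.Build _ _ transpose transpose_monoid_morphism.

Lemma transposeK : involutive transpose.
Proof. by move=> f; apply: fps_ext => i; apply: fps_ext. Qed.
End Transpose.

(** Coefficientwise power series in t are power series in the variables x_i with
    coefficients in V[[t]], to which evaluation and density apply with V[[t]] as
    ring of constants. *)
Lemma fps_mps_swap (V : comNzRingType) n :
  exists sw : {rmorphism fps (mps V n) -> mps (fps V) n},
    [/\ bijective sw, forall g, sw (fps_map (mpsC V n) g) = mpsC (fps V) n g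
      & forall i, sw (fpsC (mpsX V i)) = mpsX (fps V) i].
Proof.
elim: n => [|n [sw [[sw' swK sw'K] swC swX]]].
  exists idfun; split=> [|g|[]//]; first by exists id.
  exact: fps_ext.
pose F : {rmorphism fps (fps (mps V n)) -> fps (mps (fps V) n)} :=
  (fps_map sw \o @transpose (mps V n))%FUN.
exists F; split.
- exists (fun f => transpose (Fps (fun k => sw' (fcoef f k)))) => f.
    rewrite -[RHS]transposeK; congr transpose; apply: fps_ext => k /=.
    by rewrite swK.
  apply: fps_ext => k; rewrite -[RHS]sw'K /=; congr (sw _); exact: fps_ext.
- move=> g; apply: fps_ext => -[|k] /=.
    by rewrite -swC; congr (sw _); apply: fps_ext.
  by rewrite -[RHS](rmorph0 sw); congr (sw _); apply: fps_ext => j /=; rewrite if_same.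
move=> i /=; case: unliftP => [j _|_]; apply: fps_ext => -[|k] /=.
- by rewrite -swX; congr (sw _); apply: fps_ext => -[|l] /=.
- by rewrite -[RHS](rmorph0 sw); congr (sw _); apply: fps_ext => -[|l] /=.
- by rewrite -[RHS](rmorph0 sw); congr (sw _); apply: fps_ext => -[|l] /=.
case: k => [|k] /=; rewrite -?[0%:R](rmorph0 sw) -?[1%:R](rmorph1 sw);
  by congr (sw _); apply: fps_ext => -[|l] /=.
Qed.

Section CoefficientExtension.
Variables (V : comNzRingType) (n : nat).

Lemma fps_mps_eval (C : comPzRingType) (e : {rmorphism fps V -> C}) (c : 'I_n -> C) k :
    (forall i, c i ^+ k = 0) ->
  exists E : {rmorphism fps (mps V n) -> C},
    (forall g, E (fps_map (mpsC V n) g) = e g) /\ (forall i, E (fpsC (mpsX V i)) = c i).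
Proof.
move=> c0; have [E [EC EX]] := mps_eval e c0.
have [sw [_ swC swX]] := fps_mps_swap V n.
by exists (E \o sw)%FUN; split=> [g|i] /=; rewrite ?swC ?swX ?EC ?EX.
Qed.

Lemma fps_mps_dense k (D : fps (mps V n) -> Prop) :
    (forall g, D (fps_map (mpsC V n) g)) -> (forall i, D (fpsC (mpsX V i))) ->
    (forall f g, D f -> D g -> D (f + g)) -> (forall f g, D f -> D g -> D (f * g)) ->
    (forall f, iexp (range (fun i => fpsC (mpsX V i))) k f -> D f) ->
  forall f, D f.
Proof.
move=> DC DX DD DM Dk f.
have [sw [/rmorph_inv[sw' [swK sw'K]] swC swX]] := fps_mps_swap V n.
rewrite -(swK f); apply: (@mps_dense (fps V) n k (fun u => D (sw' u))) => [v|i|u v|u v|u hu].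
- by rewrite -swC swK.
- by rewrite -swX swK.
- by rewrite rmorphD; apply: DD.
- by rewrite rmorphM; apply: DM.
- apply: Dk; apply: iexp_igen; apply: iexp_morph hu => x.
  apply: (@igen_min _ _ (ipreim sw' (igen (range (fun i => fpsC (mpsX V i)))))) => _ [i _ <-] /=.
  by rewrite -swX swK; apply: igen_sub; exists i.
Qed.
End CoefficientExtension.

(** * Standard bases and the homogenization of an ideal *)

Section CoefficientwiseFiltration.
Variables (A : comNzRingType) (Fil : nat -> set A).
Hypothesis FilP : complete_filtration Fil.

Definition coefwise d : set (fps A) := [set f | forall k, Fil d (fcoef f k)].

Lemma coefwise_complete : complete_filtration coefwise.
Proof.
have FI d := cfil_ideal FilP d; split.
- move=> d; split=> [k|f g hf hg k|f g hg k].
  + by rewrite fcoef0; apply: (@ideal0 _ (Ideal (FI d))).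
  + exact: (@idealD _ (Ideal (FI d))).
  + rewrite fcoefM; apply: (@ideal_sum _ (Ideal (FI d))) => i _.
    exact: (@idealM _ (Ideal (FI d))).
- by move=> f k; apply: cfil0 FilP _.
- by move=> d f hf k; apply: cfilW FilP _ _ (hf k).
- move=> f hf; apply: fps_ext => k; rewrite fcoef0.
  by apply: (cfil_sep FilP) => d; apply: hf.
move=> c hc; have /choice[s sP] k : exists s, forall m, Fil m (s - \sum_(i < m) fcoef (c i) k).
  by apply: (cfil_sum FilP (c := fun i => fcoef (c i) k)) => d; apply: hc.
by exists (Fps s) => m k; rewrite fcoefB fcoef_sum; apply: sP.
Qed.
End CoefficientwiseFiltration.

Section Homogenization.
Variables (V : comNzRingType) (n : nat).
Implicit Types (f g : mps V n).

Lemma psi_div w g : hfil w g ->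
  exists h, fpsX ^+ w * h = psi g /\ forall d, fcoef h d = hpart (d + w) g.
Proof.
move=> hg; exists (Fps (fun d => hpart (d + w) g)); split=> //.
apply: fps_ext => k; rewrite fcoef_XnM; case: leqP => [wk|kw] /=; first by rewrite subnK.
by rewrite hg.
Qed.

Lemma psi_hpart d g : psi (hpart d g) = fpsX ^+ d * fpsC (hpart d g).
Proof.
apply: fps_ext => e; rewrite fcoef_XnM /= hpart_hpart subn_eq0.
by case: (ltngtP e d) => // ->.
Qed.

(** beta is t^(o - w) psi(b), a series even when w > o. *)
Lemma psi_rescale w o b : hfil (w - o) b -> exists beta : fps (mps V n),
  fpsX ^+ w * beta = fpsX ^+ o * psi b /\ forall d, hfil (w - o) (fcoef beta d).
Proof.
move=> hb; case: (leqP o w) => ow.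
  have [h [hE hd]] := psi_div hb; exists h; split=> [|d].
    by rewrite -{1}(subnKC ow) exprD -mulrA hE.
  by rewrite hd; apply: hfil_le (leq_addl d _) _; apply: hpart_hfil.
exists (fpsX ^+ (o - w) * psi b); split=> [|d].
  by rewrite mulrA -exprD subnKC // ltnW.
by rewrite (eqP (ltnW ow : (w - o == 0)%N)).
Qed.

Lemma order_hfil f i : is_order f i -> hfil i f.
Proof. by case=> /iexp_xideal. Qed.

Lemma is_order_hpart f i : hfil i f -> hpart i f != 0 -> is_order f i.
Proof.
move=> hf f0; split=> [|j /iexp_xideal hj]; first exact/iexp_xideal.
by rewrite leqNgt; apply/negP => ij; rewrite hj ?eqxx in f0.
Qed.

Variable L : ideal (mps V n).

(** The degree o j is the order of f j; a finite family of elements of L whose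
    initial forms generate those of all of L is known as a standard basis. *)
Definition standard_basis (K : finType) (f : K -> mps V n) (o : K -> nat) : Prop :=
  (forall j, [/\ L (f j), hfil (o j) (f j) & hpart (o j) (f j) != 0]) /\
  (forall w g, L g -> hfil w g ->
     exists b : K -> mps V n, hpart w g = \sum_j b j * hpart (o j) (f j)).

(** The ideal generated by all initial forms is finitely generated, and then
    already by finitely many initial forms. *)
Lemma standard_basis_exists : noetherian V ->
  exists (K : finType) (f : K -> mps V n) (o : K -> nat), standard_basis f o.
Proof.
move=> Vn.
pose X : set (mps V n) :=
  [set g | g != 0 /\ exists f d, [/\ L f, hfil d f & hpart d f = g]].
have [K [g [gX gg]]] := @noetherian_igen _ X (mps_noetherian (n := n) Vn).
have /choice[fd fdP] j : exists fd : mps V n * nat,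
    [/\ L fd.1, hfil fd.2 fd.1 & hpart fd.2 fd.1 = g j].
  by have [_ [f [d h]]] := gX j; exists (f, d).
exists K, (fun j => (fd j).1), (fun j => (fd j).2); split=> [j|w h Lh hh].
  by have [h1 h2 h3] := fdP j; split=> //; rewrite h3; have [] := gX j.
have [|b bE] := gg (hpart w h).
  case: (eqVneq (hpart w h) 0) => [->|h0]; first exact: ideal0.
  by apply: igen_sub; split=> //; exists h, w.
by exists b; rewrite bE; apply: eq_bigr => j _; have [_ _ ->] := fdP j.
Qed.

Section StandardBasis.
Variables (K : finType) (f : K -> mps V n) (o : K -> nat).
Hypothesis fP : standard_basis f o.

Let fL j : L (f j). Proof. by have [] := fP.1 j. Qed.
Let fo j : hfil (o j) (f j). Proof. by have [] := fP.1 j. Qed.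

(** With w < o', the truncated difference w - o' would give the component of
    degree zero instead of nothing. *)
Definition wpart (w o' : nat) (a : mps V n) : mps V n :=
  if (o' <= w)%N then hpart (w - o') a else 0.

Lemma wpart_hfil w o' a : hfil (w - o') (wpart w o' a).
Proof.
rewrite /wpart; case: ifP => _; first exact: hpart_hfil.
exact: (@ideal0 _ (Ideal (@hfil_ideal V n _))).
Qed.

Lemma sub_wpart_hfil w o' a : hfil (w - o') a -> hfil (w.+1 - o') (a - wpart w o' a).
Proof.
rewrite /wpart; case: leqP => ow ha; first by rewrite subSn //; apply: hfil_subhpart.
by rewrite (eqP (ow : (w.+1 - o' == 0)%N)).
Qed.

(** If the j-th coefficient is replaced by its component of degree w - o j, then
    the combination of the f j begins in degree w, with the corresponding
    combination of the initial forms. *)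
Lemma hpart_wpart (a : K -> mps V n) w e : (e <= w)%N ->
  hpart e (\sum_j wpart w (o j) (a j) * f j) =
  if e == w then hpart w (\sum_j a j * hpart (o j) (f j)) else 0.
Proof.
move=> ew; rewrite !raddf_sum; case: eqP => [->|ne] /=.
  apply: eq_bigr => j _; rewrite hpart_mulhpart /wpart.
  case: leqP => ow; last by rewrite mul0r raddf0.
  by rewrite hpart_hpartM leq_subr subKn.
rewrite big1 // => j _; rewrite /wpart; case: leqP => ow; last by rewrite mul0r raddf0.
rewrite hpart_hpartM; case: leqP => // oe; rewrite fo ?mulr0 //; lia.
Qed.

(** Subtracting a combination of the f j with homogeneous coefficients removes
    the initial form of an element of L; the remainder lies in L again and has
    larger order. *)
Lemma standard_basis_lift w g : L g -> hfil w g ->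
  exists2 b : K -> mps V n, (forall j, hfil (w - o j) (b j)) & g = \sum_j b j * f j.
Proof.
move=> Lg hg.
apply: (@successive_approximation _ _ (hfil_complete V n) K f o 0%N
  (fun w => [set g | L g /\ hfil w g])) => // {w g Lg hg} [w g [_]|w g [Lg hg]].
  by rewrite subn0.
have [b bE] := fP.2 _ _ Lg hg.
exists (fun j => wpart w (o j) (b j)) => [j|]; first exact: wpart_hfil.
split=> [|e]; first by apply: idealB => //; apply: ideal_sum => j _; apply: idealM.
rewrite ltnS raddfB /= => ew; rewrite hpart_wpart //.
case: eqP => [->|/eqP ne]; last by rewrite hg ?subrr // ltn_neqAle ne.
by rewrite -bE hpart_hpart eqxx subrr.
Qed.

Variable h : K -> fps (mps V n).
Hypothesis hE : forall j, fpsX ^+ o j * h j = psi (f j).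

Let h0 j : fcoef (h j) 0 = hpart (o j) (f j).
Proof.
by have := congr1 (fun u => fcoef u (o j)) (hE j); rewrite fcoef_XnM leqnn subnn.
Qed.

Lemma hom_ideal_basis j : hom_ideal L (h j).
Proof.
have [Lf hf f0] := fP.1 j; apply: igen_sub; exists (f j); split=> //.
  by apply: contraNneq f0 => ->; rewrite raddf0.
by exists (o j) => //; apply: is_order_hpart.
Qed.

(** The expansion of g in the f j is rescaled: beta j is t^(o j - w) psi(b j),
    where b j has order at least w - o j. *)
Lemma psi_lift w g u : L g -> hfil w g -> fpsX ^+ w * u = psi g ->
  exists2 beta : K -> fps (mps V n),
    (forall j, coefwise (@hfil V n) (w - o j) (beta j)) & u = \sum_j beta j * h j.
Proof.
move=> Lg hg uE; have [b hb gE] := standard_basis_lift Lg hg.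
have /choice[beta betaP] j := psi_rescale (hb j).
exists beta => [j k|]; first exact: (betaP j).2.
apply: (@fpsX_cancel _ w); rewrite uE gE rmorph_sum mulr_sumr.
apply: eq_bigr => j _; rewrite rmorphM mulrA (betaP j).1 mulrAC hE.
exact: mulrC.
Qed.

Lemma hom_ideal_lincomb u : hom_ideal L u ->
  exists a : K -> fps (mps V n), u = \sum_j a j * h j.
Proof.
move=> hu; apply: igen_lincomb; move: u hu; apply: igen_min => u [g [Lg _ [i gi uE]]].
have [beta _ ->] := psi_lift Lg (order_hfil gi) uE.
by apply: ideal_sum => j _; apply: idealM; apply: igen_sub; exists j.
Qed.

(** The relation between the initial forms makes the initial terms of the
    combination g of the f j cancel: g lies in L and has order greater than w.
    Expanding it again in the f j therefore gains a factor t. *)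
Lemma syzygy_lift (a : K -> mps V n) w :
    (forall j, hfil (w - o j) (a j)) -> \sum_j a j * hpart (o j) (f j) = 0 ->
  exists2 beta : K -> fps (mps V n),
    (forall j, coefwise (@hfil V n) (w - o j) (beta j)) &
    fpsX * (\sum_j beta j * h j) = \sum_j fpsC (wpart w (o j) (a j)) * h j.
Proof.
move=> ha a0; pose g := \sum_j wpart w (o j) (a j) * f j.
have Lg : L g by apply: ideal_sum => j _; apply: idealM.
have hg : hfil w.+1 g.
  by move=> e; rewrite ltnS => ew; rewrite hpart_wpart // a0 raddf0 if_same.
have [u [uE _]] := psi_div hg.
have [beta betaP uh] := psi_lift Lg hg uE; exists beta => [j k|].
  by apply: hfil_le (betaP j k); apply: leq_sub2r.
apply: (@fpsX_cancel _ w); rewrite mulrA -exprSr -uh uE rmorph_sum mulr_sumr.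
apply: eq_bigr => j _; rewrite rmorphM /= -hE mulrA [RHS]mulrA; congr (_ * _).
rewrite /wpart; case: leqP => [ow|_]; last by rewrite !rmorph0 mulr0 mul0r.
by rewrite psi_hpart mulrAC -exprD subnK.
Qed.

(** Let t u be a combination of the h j. Up to multiples of t, its coefficients
    are constant in t; setting t = 0 gives a relation between the initial forms,
    and lifting its part of degree w replaces u by an element of larger order
    modulo the ideal. The process converges for the filtration of T by the
    degree of the coefficients. *)
Lemma hom_ideal_t_regular u : hom_ideal L (fpsX * u) -> hom_ideal L u.
Proof.
move=> /hom_ideal_lincomb[A AE].
pose P w : set (fps (mps V n)) := [set u | exists2 a : K -> mps V n,
  (forall j, hfil (w - o j) (a j)) & fpsX * u = \sum_j fpsC (a j) * h j].
have /choice[A' A'E] j : exists A', A j = fpsC (fcoef (A j) 0) + fpsX * A'.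
  have [A' ->] := fps_decomp 1 (A j); exists A'.
  by rewrite big_ord_recl big_ord0 addr0 !expr0 mul1r expr1 fcoefD fcoef_XM addr0.
have Pu : P 0%N (u - \sum_j A' j * h j).
  exists (fun j => fcoef (A j) 0) => //; rewrite mulrBr AE mulr_sumr -sumrB.
  by apply: eq_bigr => j _; rewrite {1}A'E mulrDl mulrA addrK.
have [||a _ uE] := @successive_approximation _ _
    (coefwise_complete (hfil_complete V n)) K h o (\sum_j o j)%N P _ _ _ _ Pu.
- move=> w g [a ha gE] k.
  have -> : fcoef g k = fcoef (fpsX * g) k.+1 by rewrite fcoef_XM.
  rewrite gE fcoef_sum; apply: (@ideal_sum _ (Ideal (@hfil_ideal V n _))) => j _.
  rewrite fcoef_CM mulrC; apply: (@idealM _ (Ideal (@hfil_ideal V n _))).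
  by apply: hfil_le (ha j); rewrite (bigD1 j) //=; lia.
- move=> w g [a ha gE].
  have [||beta betaP bE] := @syzygy_lift a w => //.
    have := congr1 (fun v => fcoef v 0) gE; rewrite fcoef_XM fcoef_sum => /esym e.
    by rewrite -[RHS]e; apply: eq_bigr => j _; rewrite fcoef_CM h0.
  exists beta => //; exists (fun j => a j - wpart w (o j) (a j)) => [j|].
    exact: sub_wpart_hfil.
  rewrite mulrBr gE bE -sumrB; apply: eq_bigr => j _.
  by rewrite rmorphB mulrBl.
rewrite -(subrK (\sum_j A' j * h j) u); apply: idealD; last first.
  by apply: ideal_sum => j _; apply: idealM; apply: hom_ideal_basis.
by rewrite uE; apply: ideal_sum => j _; apply: idealM; apply: hom_ideal_basis.
Qed.

(** An ideal with finitely many homogeneous generators contains every series all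
    of whose components lie in it: the coefficients can be assembled degree by
    degree. *)
Lemma initial_ideal_closed g :
    (forall d, exists l, [/\ L l, hfil d l & hpart d g = hpart d l]) <->
    exists a : K -> mps V n, g = \sum_j a j * hpart (o j) (f j).
Proof.
split=> [gP|[a ->] d].
  have /choice[c cE] d : exists c : K -> mps V n,
      hpart d g = \sum_j c j * hpart (o j) (f j).
    have [l [Ll hl ->]] := gP d; exact: fP.2.
  exists (fun j => assemble (fun e => c (e + o j)%N j)); apply: hpart_ext => d.
  have -> : hpart d g = hpart d (\sum_j c d j * hpart (o j) (f j)).
    by rewrite -cE hpart_hpart eqxx.
  rewrite !raddf_sum; apply: eq_bigr => j _ /=; rewrite !hpart_mulhpart.
  by case: leqP => // od; rewrite hpart_assemble subnK.
exists (\sum_j wpart d (o j) (a j) * f j); split.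
- by apply: ideal_sum => j _; apply: idealM.
- by move=> e ed; rewrite hpart_wpart ?ltn_eqF // ltnW.
- by rewrite hpart_wpart // eqxx.
Qed.

End StandardBasis.

Lemma standard_basis_hom (K : finType) (f : K -> mps V n) (o : K -> nat) :
    standard_basis f o ->
  exists h : K -> fps (mps V n), forall j, fpsX ^+ o j * h j = psi (f j).
Proof.
move=> fP; have /choice[h hE] j : exists h, fpsX ^+ o j * h = psi (f j).
  by have [_ fo _] := fP.1 j; have [h [hE _]] := psi_div fo; exists h.
by exists h.
Qed.

Lemma hom_ideal_regular u : noetherian V ->
  hom_ideal L (fpsX * u) -> hom_ideal L u.
Proof.
move=> /standard_basis_exists[K [f [o fP]]]; have [h hE] := standard_basis_hom fP.
exact (@hom_ideal_t_regular K f o fP h hE u).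
Qed.

(** For t = 0, the generator t^(-i) psi(f) becomes the initial form of f. *)
Lemma hom_ideal_mod_t u : noetherian V ->
  (forall d, exists l, [/\ L l, hfil d l & hpart d (fcoef u 0) = hpart d l]) <->
  exists v, hom_ideal L (u - fpsX * v).
Proof.
move=> /standard_basis_exists[K [f [o fP]]]; have [h hE] := standard_basis_hom fP.
have h0 j : fcoef (h j) 0 = hpart (o j) (f j).
  by have := congr1 (fun v => fcoef v (o j)) (hE j); rewrite fcoef_XnM leqnn subnn.
rewrite (initial_ideal_closed fP); split=> [[a uE]|[v]].
  pose s := \sum_j fpsC (a j) * h j.
  have [v vE] := fps_decomp 1 (u - s); exists v.
  have -> : u - fpsX * v = s.
    apply/eqP; rewrite subr_eq addrC -subr_eq; apply/eqP; rewrite vE.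
    rewrite big_ord_recl big_ord0 addr0 fcoefB uE fcoef_sum -sumrB big1 ?rmorph0.
      by rewrite mulr0 add0r expr1.
    by move=> j _; rewrite fcoef_CM h0 subrr.
  by apply: ideal_sum => j _; apply: idealM; exact: (hom_ideal_basis fP hE j).
move=> /(hom_ideal_lincomb fP hE)[a aE]; exists (fun j => fcoef (a j) 0).
have -> : fcoef u 0 = fcoef (u - fpsX * v) 0 by rewrite fcoefB fcoef_XM subr0.
rewrite aE fcoef_sum; apply: eq_bigr => j _.
by rewrite fcoefM big_ord_recl big_ord0 addr0 subn0 h0.
Qed.

Lemma psi_hom_ideal g : noetherian V -> L g -> hom_ideal L (psi g).
Proof.
move=> /standard_basis_exists[K [f [o fP]]] Lg; have [h hE] := standard_basis_hom fP.
have [//||beta _ ->] := psi_lift fP hE (w := 0) (g := g) (u := psi g) Lg.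
  by rewrite expr0 mul1r.
by apply: ideal_sum => j _; apply: idealM; exact: (hom_ideal_basis fP hE j).
Qed.

(** The generators of the homogenization differ from the series psi(g) by powers
    of t, and tau is the inverse of the image of t. *)
Lemma hom_ideal_kernel (C : comPzRingType) (F : {rmorphism fps (mps V n) -> C}) tau u :
    tau * F fpsX = 1 -> (forall g, L g -> F (psi g) = 0) ->
  hom_ideal L u -> F u = 0.
Proof.
move=> tF FL; have F0 : is_ideal [set v | F v = 0].
  split=> [|x y hx hy|a x hx] /=; first exact: rmorph0.
    by rewrite rmorphD hx hy addr0.
  by rewrite rmorphM hx mulr0.
apply: (@igen_min _ _ (Ideal F0)) => v [g [Lg _ [i _ vE]]] /=.
have := FL g Lg; rewrite -vE rmorphM rmorphXn => e.
by rewrite -[F v]mul1r -(expr1n _ i) -tF exprMn -mulrA e mulr0.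
Qed.

End Homogenization.

(** * The completed associated graded ring *)

Section GradedPowers.
Variables (A : comNzRingType) (M : ideal A).
Local Notation rees := (rees M).
Local Notation qgr := (qpi (gr_ideal M)).

Lemma rees_coef (f : rees) i : iexp M i (val f)`_i.
Proof. by have /rees_predP := valP f. Qed.

Lemma rees_sub (p : {poly A}) : (forall i, iexp M i p`_i) -> exists f : rees, val f = p.
Proof. by move=> /rees_predP h; exists (Sub p h); rewrite SubK. Qed.

Lemma iexpM_eq (X : set A) k i j a b : k = (i + j)%N ->
  iexp X i a -> iexp X j b -> iexp X k (a * b).
Proof. by move=> ->; apply: iexpM. Qed.

(** M^d is generated by the products of an element of M, which has degree one in
    the Rees algebra, and an element of M^(d-1). *)
Lemma gr_plus_mono k d a : (k <= d)%N -> iexp M d a ->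
  exists f : rees, val f = a *: 'X^d /\ iexp (gr_plus (M := M)) k (qgr f).
Proof.
elim: k d a => [|k IH] d a kd ha.
  have [|f fE] := @rees_sub (a *: 'X^d); last by exists f.
  move=> i; rewrite coefZ coefXn; case: eqP => [->|_]; rewrite ?mulr1 ?mulr0 //.
  exact: ideal0.
case: d kd ha => // d kd ha.
pose P : set A := [set a | exists f : rees,
  val f = a *: 'X^(d.+1) /\ iexp (gr_plus (M := M)) k.+1 (qgr f)].
have PI : is_ideal P.
  split=> [|x y [f [fE hf]] [g [gE hg]]|c x [f [fE hf]]].
  - by exists 0; rewrite !rmorph0 scale0r; split=> //; apply: ideal0.
  - exists (f + g); rewrite [qgr _]rmorphD; split; last exact: idealD.
    by rewrite rmorphD /= fE gE scalerDl.
  - exists (Sub c%:P (gr0_subproof M c) * f); rewrite [qgr _]rmorphM; split; last exact: idealM.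
    by rewrite rmorphM /= fE mul_polyC scalerA.
apply: (@igen_min _ _ (Ideal PI) _ a ha) => _ [y My [z hz <-]].
have [g [gE hg]] := IH d z kd hz.
have [|f fE] := @rees_sub (y *: 'X).
  move=> i; rewrite coefZ coefX; case: eqP => [->|_]; last by rewrite mulr0; apply: ideal0.
  by rewrite mulr1; apply: igen_sub; exists y => //; exists 1; rewrite ?mulr1.
exists (f * g); split.
  by rewrite rmorphM /= fE gE -scalerAl -scalerAr scalerA -exprS.
rewrite rmorphM; apply: igen_sub; exists (qgr f).
  by exists f => //=; rewrite fE coefZ coefX mulr0.
by exists (qgr g).
Qed.

(** A product of k elements of G_+ has no component of degree less than k, and
    gr_plus_mono is the converse. The component of degree i of the class of f
    vanishes if and only if the coefficient of f lies in M^(i+1). *)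
Lemma gr_plus_exp k (f : rees) : iexp (gr_plus (M := M)) k (qgr f) <->
  forall i, (i < k)%N -> iexp M i.+1 (val f)`_i.
Proof.
split=> [|hf].
  pose Y k : set (gr M) := [set u | exists2 f : rees,
    u = qgr f & forall i, (i < k)%N -> iexp M i.+1 (val f)`_i].
  have YI l : is_ideal (Y l).
    split=> [|_ _ [g -> hg] [h -> hh]|c _ [g -> hg]].
    - by exists 0; rewrite ?rmorph0 // => i _; rewrite coef0; apply: ideal0.
    - exists (g + h); first by rewrite rmorphD.
      by move=> i il; rewrite rmorphD coefD; apply: idealD; [apply: hg|apply: hh].
    - have [e ->] := qpi_surj c; exists (e * g); first by rewrite rmorphM.
      move=> i il; rewrite rmorphM coefM; apply: ideal_sum => j _.
      apply: (@iexpM_eq _ _ j (i - j).+1); first by rewrite addnS subnKC // -ltnS.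
        exact: rees_coef.
      by apply: hg; apply: leq_ltn_trans (leq_subr _ _) il.
  have : forall u, iexp (gr_plus (M := M)) k u -> Y k u.
    elim: k {f} => [|k IH] u.
      by have [f ->] := qpi_surj u; exists f.
    apply: (@igen_min _ _ (Ideal (YI k.+1))) => _ [_ [g g0 <-] [z /IH[h -> hh] <-]].
    exists (g * h); first by rewrite rmorphM.
    move=> i; rewrite ltnS => ik; rewrite rmorphM coefM; apply: ideal_sum => j _.
    case: (posnP j) => [j0|j0].
      by rewrite j0 [X in X * _]g0 mul0r; apply: ideal0.
    apply: (@iexpM_eq _ _ j (i - j).+1); first by rewrite addnS subnKC // -ltnS.
      exact: rees_coef.
    by apply: hh; have := ltn_ord j; lia.
  move=> /[apply] -[g /qpi_eq fg hg] i ik.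
  rewrite -(subrK (val g)`_i (val f)`_i); apply: idealD; last exact: hg.
  by have := fg i; rewrite rmorphB coefB.
have /choice[m mP] i : exists m : rees, val m = (val f)`_i *: 'X^i /\
    ((k <= i)%N -> iexp (gr_plus (M := M)) k (qgr m)).
  case: (leqP k i) => ki.
    by have [m [mE hm]] := gr_plus_mono ki (rees_coef f i); exists m.
  have [m [mE _]] := gr_plus_mono (leq0n i) (rees_coef f i).
  by exists m.
have -> : f = \sum_(i < size (val f)) m i.
  apply: val_inj; rewrite rmorph_sum /= -[LHS]coefK poly_def.
  by apply: eq_bigr => i _; rewrite (mP i).1.
rewrite rmorph_sum; apply: ideal_sum => i _; case: (leqP k i) => ki; first exact: (mP i).2.
suff /qpi_eq0 e : gr_ideal M (m i).
  by have := ideal0 (iexp (gr_plus (M := M)) k); rewrite -e.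
move=> j; rewrite (mP i).1 coefZ coefXn; case: eqP => [->|_].
  by rewrite mulr1; apply: hf.
by rewrite mulr0; apply: ideal0.
Qed.

Lemma gr_quot_eq k (f g : rees) :
  qpi (iexp (gr_plus (M := M)) k) (qgr f) = qpi _ (qgr g) <->
  forall i, (i < k)%N -> iexp M i.+1 ((val f)`_i - (val g)`_i).
Proof.
rewrite qpi_eq -rmorphB gr_plus_exp; split=> h i /h; by rewrite rmorphB coefB.
Qed.

End GradedPowers.

Section GradedPresentation.
Variables (V A : comNzRingType) (N : nat) (M : ideal A).
Variable theta : {rmorphism mps V N -> A}.
Hypothesis theta_surj : forall a, exists f, theta f = a.
Hypothesis thetaM : forall a, M a <-> exists2 f, hfil 1 f & theta f = a.

(** As theta is surjective, products of elements of M lift to products of series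
    without constant term. *)
Lemma iexp_presentation k a : iexp M k a <-> exists2 f, hfil k f & theta f = a.
Proof.
have hI l : is_ideal [set a | exists2 f, hfil l f & theta f = a].
  have I := @hfil_ideal V N l.
  split=> [|_ _ [f hf <-] [g hg <-]|c _ [f hf <-]].
  - by exists 0; [apply: (@ideal0 _ (Ideal I))|apply: rmorph0].
  - by exists (f + g); [apply: (@idealD _ (Ideal I))|apply: rmorphD].
  - have [g <-] := theta_surj c.
    by exists (g * f); [apply: (@idealM _ (Ideal I))|apply: rmorphM].
split=> [|[f /iexp_xideal hf <-]].
  elim: k a => [|k IH] a; first by have [f <-] := theta_surj a; exists f.
  apply: (@igen_min _ _ (Ideal (hI k.+1))) => _ [y /thetaM[f hf <-] [z /IH[g hg <-] <-]].
  by exists (f * g); [rewrite -add1n; apply: hfilM|apply: rmorphM].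
apply: iexp_morph hf; apply: (@igen_min _ _ (ipreim theta M)) => _ [i _ <-] /=.
by apply/thetaM; exists (mpsX V i) => //; apply: mpsX_hfil.
Qed.

Lemma hpart_presentation d f : iexp M d (theta (hpart d f)).
Proof. by apply/iexp_presentation; exists (hpart d f) => //; apply: hpart_hfil. Qed.

(** rho f is the sequence of the classes of theta (hpart d f) in M^d / M^(d+1).
    It is surjective since the components of f can be prescribed. Its kernel
    consists of the f with theta (hpart d f) in M^(d+1) for all d; subtracting
    from hpart d f a preimage in hfil (d + 1) gives an element of the kernel of
    theta with the same component of degree d. *)
Lemma gr_completion_presentation :
  exists rho : {rmorphism mps V N -> completion (gr_plus (M := M))},
  [/\ forall c, exists f, rho f = c,
      forall f, rho f = 0 <-> forall d, exists l,
        [/\ theta l = 0, hfil d l & hpart d f = hpart d l]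
    & forall v, rho (mpsC V N v) = to_completion _ (gr0 M (theta (mpsC V N v)))].
Proof.
pose p k f := \poly_(d < k) theta (hpart d f).
have /choice[tr trE] (kf : nat * mps V N) : exists r : rees M, val r = p kf.1 kf.2.
  apply: rees_sub => i; rewrite coef_poly; case: ifP => _; last exact: ideal0.
  exact: hpart_presentation.
have tr_coef k f i : (i < k)%N -> (val (tr (k, f)))`_i = theta (hpart i f).
  by move=> ik; rewrite trE coef_poly ik.
pose cs f k := qpi (iexp (gr_plus (M := M)) k) (qpi (gr_ideal M) (tr (k, f))).
have csP f k : exists a, cs f k = qpi _ a /\ cs f k.+1 = qpi _ a.
  exists (qpi (gr_ideal M) (tr (k.+1, f))); split=> //; apply/gr_quot_eq => i ik.
  by rewrite (tr_coef _ _ _ ik) (tr_coef _ _ _ (leqW ik)) subrr; apply: ideal0.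
have csE f k (g : rees M) :
    (forall i, (i < k)%N -> iexp M i.+1 (theta (hpart i f) - (val g)`_i)) <->
    cs f k = qpi _ (qpi (gr_ideal M) g).
  by rewrite gr_quot_eq; split=> h i ik; have := h i ik; rewrite tr_coef.
have [||rho rhoE] := @rmorphism_of (mps V N) (completion (gr_plus (M := M)))
    (fun f => Completion (csP f)).
- move=> f g; apply: cseq_inj => k /=; rewrite -!rmorphB; apply/csE => i ik.
  rewrite rmorphB coefB !tr_coef //.
  have -> : hpart i (f - g) = hpart i f - hpart i g by apply: raddfB.
  by rewrite rmorphB subrr; apply: ideal0.
- split=> [|f g]; apply: cseq_inj => k /=.
    rewrite -(rmorph1 (qpi (gr_ideal M))); apply/csE => i ik.
    rewrite hpart1 rmorph_nat rmorph1 coef1 subrr; exact: ideal0.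
  rewrite -!rmorphM; apply/csE => i ik; rewrite rmorphM coefM hpartM rmorph_sum -sumrB.
  apply: ideal_sum => j _; have ji : (j <= i)%N by rewrite -ltnS.
  rewrite !tr_coef ?(leq_ltn_trans _ ik) ?leq_subr // rmorphM subrr; exact: ideal0.
have rho0 f : rho f = 0 <-> forall d, iexp M d.+1 (theta (hpart d f)).
  rewrite rhoE; split=> [e d|h].
    have e' : cs f d.+1 = qpi _ (qpi (gr_ideal M) 0).
      by rewrite !rmorph0; apply: (congr1 (fun c => cseq c d.+1) e).
    by have := (csE _ _ _).2 e' d (ltnSn d); rewrite rmorph0 coef0 subr0.
  apply: cseq_inj => k /=; rewrite -(rmorph0 (qpi (gr_ideal M))); apply/csE => i _.
  by rewrite rmorph0 coef0 subr0.
exists rho; split=> [c|f|v].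
- have /choice[g gE] k : exists g, cseq c k = qpi _ (qpi (gr_ideal M) g).
    have [u ->] := qpi_surj (cseq c k); have [g ->] := qpi_surj u.
    by exists g.
  have gS k i : (i < k)%N -> iexp M i.+1 ((val (g k))`_i - (val (g k.+1))`_i).
    have [u] := cseqP c k; have [e ->] := qpi_surj u => -[].
    rewrite !gE => /gr_quot_eq h1 /gr_quot_eq h2 ik.
    rewrite -(subrKA (val e)`_i); apply: idealD; first exact: h1.
    by rewrite -opprB; apply: idealN; apply: h2; apply: leqW.
  have gi k i : (i < k)%N -> iexp M i.+1 ((val (g i.+1))`_i - (val (g k))`_i).
    move=> /subnK<-; elim: (k - i.+1)%N => [|m IH]; first by rewrite subrr; apply: ideal0.
    rewrite -(subrKA (val (g (m + i.+1)%N))`_i); apply: idealD => //.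
    by apply: gS; rewrite addnS ltnS leq_addl.
  have /choice[s sP] d : exists s, hfil d s /\ theta s = (val (g d.+1))`_d.
    have /iexp_presentation[s h1 h2] := rees_coef (g d.+1) d.
    by exists s.
  exists (assemble s); rewrite rhoE; apply: cseq_inj => k; rewrite gE; apply/csE => i ik.
  rewrite hpart_assemble -(subrKA (val (g i.+1))`_i); apply: idealD; last exact: gi.
  rewrite -(sP i).2 -rmorphB -opprB rmorphN; apply: idealN; apply/iexp_presentation.
  by exists (s i - hpart i (s i)) => //; apply: hfil_subhpart; apply: (sP i).1.
- rewrite rho0; split=> h d.
    have /iexp_presentation[s hs sE] := h d.
    exists (hpart d f - s); split; first by rewrite rmorphB sE subrr.
      apply: (@idealB _ (Ideal (@hfil_ideal V N d))); first exact: hpart_hfil.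
      exact: hfil_le (leqnSn d) hs.
    by rewrite raddfB /= hpart_hpart eqxx hs ?subr0.
  have [l [l0 hl ->]] := h d; apply/iexp_presentation; exists (hpart d l - l).
    by rewrite -opprB; apply: (@idealN _ (Ideal (@hfil_ideal V N _))); apply: hfil_subhpart.
  by rewrite rmorphB l0 subr0.
- rewrite rhoE; apply: cseq_inj => k /=; apply/csE => -[|i] _.
    by rewrite hpart_mpsC SubK coefC subrr; apply: ideal0.
  by rewrite hpart_mpsC SubK coefC rmorph0 subrr; apply: ideal0.
Qed.

End GradedPresentation.

(** * Regularity of t and the special fibre *)

Lemma igen1P (A : comPzRingType) (a x : A) : igen [set a] x <-> exists c, x = c * a.
Proof.
split=> [|[c ->]]; last by apply: idealM; apply: igen_sub.
have PI : is_ideal [set x | exists c, x = c * a].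
  split=> [|y z [c ->] [d ->]|b y [c ->]].
  - by exists 0; rewrite mul0r.
  - by exists (c + d); rewrite mulrDl.
  - by exists (b * c); rewrite mulrA.
by apply: (@igen_min _ _ (Ideal PI)) => _ ->; exists 1; rewrite mul1r.
Qed.

Lemma dvr_noetherian (V : idomainType) (M : ideal V) : is_dvr M -> noetherian V.
Proof.
case=> pid _ _ J; have [a [aJ Ja]] := pid J; exists unit, (fun=> a).
split=> [_|x /aJ/igen1P[c ->]]; first by apply: Ja; apply: igen_sub.
by exists (fun=> c); rewrite (bigD1 tt) //= big1 ?addr0 // => -[].
Qed.

Lemma maximal_or (A : comPzRingType) (M : ideal A) x : is_maximal M ->
  M x \/ exists a, M (1 - a * x).
Proof.
move=> [_ Mmax]; pose P : set A := [set y | exists a, M (y - a * x)].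
have PI : is_ideal P.
  split=> [|y z [a ha] [b hb]|c y [a ha]].
  - by exists 0; rewrite mul0r subrr; apply: ideal0.
  - by exists (a + b); rewrite mulrDl opprD addrACA; apply: idealD.
  - by exists (c * a); rewrite -mulrA -mulrBr; apply: idealM.
have [|[a ha]|PM] := Mmax (Ideal PI).
- by move=> y My; exists 0; rewrite mul0r subr0.
- by right; exists a.
- by left; apply: PM; exists 1; rewrite mul1r subrr; apply: ideal0.
Qed.

Section Presentation.
Variables (p n : nat) (V : idomainType) (R : comNzRingType).
Variables (M : ideal R) (I : ideal (mps V n)) (phi : {rmorphism quot I -> R}).
Variable pi : {rmorphism mps V n.+1 -> mps V n}.
Hypothesis Vdvr : is_dvr (igen [set p%:R : V]).
Hypothesis Mlocal : is_local M.
Hypothesis charM : has_characteristic (quot M) p.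
Hypothesis phi_bij : bijective phi.
Hypothesis piP : is_eval_at_p pi p.

Local Notation S := (mps V n.+1).
Local Notation L := (ipreim pi I).
Local Notation H := (hom_ideal L).

Definition S_to_R : {rmorphism S -> R} := (phi \o qpi I \o pi)%FUN.
Local Notation theta := S_to_R.

Let Vn : noetherian V := dvr_noetherian Vdvr.

Lemma S_to_R_surj a : exists f, theta f = a.
Proof.
have [psi _ phiK] := phi_bij; have [q qE] := qpi_surj (psi a).
by exists (fpsC q); rewrite /S_to_R /= piP.1 -qE phiK.
Qed.

Lemma S_to_R_eq0 f : theta f = 0 <-> L f.
Proof.
rewrite /S_to_R /=; split=> [e|/qpi_eq0 e]; last by rewrite [qpi I _]e rmorph0.
by apply/qpi_eq0; apply: (bij_inj phi_bij); rewrite rmorph0.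
Qed.

Lemma S_to_R_mpsC v : theta (mpsC V n.+1 v) = V_to_R phi v.
Proof. by rewrite /S_to_R /= piP.1. Qed.

Lemma S_to_R_X : theta (fpsX : S) = p%:R.
Proof. by rewrite /S_to_R /= piP.2 !rmorph_nat. Qed.

Lemma p_in_M : M p%:R.
Proof. by apply/qpi_eq0; rewrite rmorph_nat; apply/charM. Qed.

(** If f has no constant term, then 1 - b f is a unit of S for all b, hence
    theta f belongs to the maximal ideal. Conversely, the constant term v of a
    preimage of an element of M lies in p V, as otherwise 1 would be a
    combination of p and v; and the constant p has the same image as x_1. *)
Lemma M_presentation a : M a <-> exists2 f, hfil 1 f & theta f = a.
Proof.
have [[M1 Mmax] _] := Mlocal.
have fM (f : S) : hfil 1 f -> M (theta f).
  move=> hf; have [//|[r]] := maximal_or (theta f) (conj M1 Mmax).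
  have [b <-] := S_to_R_surj r; rewrite -rmorphM -(rmorph1 theta) -rmorphB => hM.
  have [|g gE] := @mps_unit _ _ (1 - b * f).
    have -> : hpart 0 (1 - b * f) = hpart 0 1 - hpart 0 (b * f) by apply: raddfB.
    rewrite hpart1 (_ : hpart 0 (b * f) = 0) ?subr0 //.
    by apply: (@idealM _ (Ideal (@hfil_ideal V n.+1 1)) _ _ hf).
  by case: M1; rewrite -(rmorph1 theta) -gE rmorphM; apply: idealM.
split=> [|[f hf <-]]; last exact: fM.
have [f <- Mf] := S_to_R_surj a.
have [v vE] := hpart0_const f.
have hf1 : hfil 1 (f - hpart 0 f) by apply: hfil_subhpart.
have Mv : M (theta (mpsC V n.+1 v)).
  rewrite -vE -(subKr f (hpart 0 f)) rmorphB; apply: idealB => //; exact: fM.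
have [_ [Vmax _] _] := Vdvr.
have [/igen1P[c cE]|[a' /igen1P[c cE]]] := maximal_or v Vmax.
  exists (mpsC V n.+1 c * fpsX + (f - hpart 0 f)).
    apply: (@idealD _ (Ideal (@hfil_ideal V n.+1 1))) => //.
    apply: (@idealM _ (Ideal (@hfil_ideal V n.+1 1))).
    by have := @mpsX_hfil V n.+1 ord0; rewrite /= unlift_none.
  rewrite rmorphD rmorphM S_to_R_X -(rmorph_nat theta) -(rmorph_nat (mpsC V n.+1)).
  by rewrite -!rmorphM -cE -vE -rmorphD addrC subrK.
case: M1; have -> : 1 = theta (mpsC V n.+1 a') * theta (mpsC V n.+1 v)
    + theta (mpsC V n.+1 c) * p%:R.
  rewrite -(rmorph_nat theta) -(rmorph_nat (mpsC V n.+1)) -!rmorphM -!rmorphD -cE.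
  by rewrite addrC subrK !rmorph1.
by apply: idealD; apply: idealM => //; apply: p_in_M.
Qed.

Lemma homR_t_regular (u : homR I pi) : homR_t I pi * u = 0 -> u = 0.
Proof.
have [w ->] := qpi_surj u; rewrite -[homR_t I pi]/(qpi H fpsX) -rmorphM.
by move=> /qpi_eq0/(hom_ideal_regular Vn) h; apply/qpi_eq0.
Qed.

Lemma homR_mod_t_iso : exists F : {rmorphism homR_mod_t I pi -> gr_completion M},
  bijective F /\ forall v, F (V_to_homR_mod_t I pi v) = V_to_gr_completion M phi v.
Proof.
have [rho [rhos rho0 rhoC]] := gr_completion_presentation S_to_R_surj M_presentation.
have [||c cE] := @rmorphism_of (fps S) S (fun u => fcoef u 0).
- by [].
- by split=> // u v; rewrite fcoefM big_ord_recl big_ord0 addr0 subn0.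
have rhoP u : rho (c u) = 0 <-> exists v, H (u - fpsX * v).
  rewrite rho0 cE -(hom_ideal_mod_t _ u Vn); split=> h d; have [l [h1 h2 h3]] := h d;
    by exists l; split=> //; apply/S_to_R_eq0.
have [|F1 F1E] := @quot_lift _ _ H (rho \o c)%FUN.
  by move=> u hu; apply/rhoP; exists 0; rewrite mulr0 subr0.
have [||F [Fbij FE]] := @quot_iso _ _ (igen [set homR_t I pi]) F1.
- move=> x; have [u ->] := qpi_surj x; rewrite F1E /= rhoP; apply: (iff_trans (igen1P _ _)).
  split=> [[y]|[v hv]].
    have [v ->] := qpi_surj y => e; exists v; apply/qpi_eq0.
    by rewrite rmorphB rmorphM mulrC [X in X - _]e subrr.
  exists (qpi H v); rewrite -[homR_t I pi]/(qpi H fpsX) -rmorphM; apply/qpi_eq.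
  by rewrite mulrC.
- move=> b; have [f <-] := rhos b; exists (qpi H (fpsC f)).
  by rewrite F1E /= cE.
exists F; split=> // v.
rewrite -[V_to_homR_mod_t I pi v]/(qpi _ (qpi H (fpsC (mpsC V n.+1 v)))).
by rewrite FE F1E /= cE rhoC S_to_R_mpsC.
Qed.

End Presentation.

(** * The generic fibre *)

Lemma fps_map_X (A B : comNzRingType) (s : {rmorphism A -> B}) : fps_map s fpsX = fpsX.
Proof. by apply: fps_ext => k; rewrite /= rmorph_nat. Qed.

Lemma fps_map_C (A B : comNzRingType) (s : {rmorphism A -> B}) a :
  fps_map s (fpsC a) = fpsC (s a).
Proof. by apply: fps_ext => -[|k] //=; rewrite rmorph0. Qed.

(** E is the evaluation of the coefficients at the elements s(x_i) tau, where tau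
    is the inverse of t. They are nilpotent because s kills a power of the ideal
    of the variables. As psi replaces x_i by x_i t, it turns E into s. *)
Lemma psi_eval (V : comNzRingType) N (C : comPzRingType) (s : {rmorphism mps V N -> C})
    (e : {rmorphism fps V -> C}) (tau : C) k :
    (forall v, s (mpsC V N v) = e (fpsC v)) -> tau * e fpsX = 1 ->
    (forall f, iexp (range (@mpsX V N)) k f -> s f = 0) ->
  exists E : {rmorphism fps (mps V N) -> C},
    [/\ forall g, E (fps_map (mpsC V N) g) = e g,
        forall i, E (fpsC (mpsX V i)) = s (mpsX V i) * tau
      & forall f, E (psi f) = s f].
Proof.
move=> se tauK s0.
have [|E [EC EX]] := @fps_mps_eval V N C e (fun i => s (mpsX V i) * tau) k.
  by move=> i; rewrite exprMn -rmorphXn s0 ?mul0r //; apply: iexpX; exists i.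
exists E; split=> // f.
have EpsiX i : E (psi (mpsX V i)) = s (mpsX V i).
  rewrite psi_mpsX rmorphM EX -(fps_map_X (mpsC V N)) EC.
  by rewrite -mulrA tauK mulr1.
apply: (@mps_dense V N k (fun f => E (psi f) = s f)) f => [v||f g ef eg|f g ef eg|f hf].
- by rewrite psi_mpsC -fps_map_C EC se.
- exact: EpsiX.
- by rewrite !rmorphD ef eg.
- by rewrite !rmorphM ef eg.
have hf' := iexp_igen hf; rewrite s0 //.
apply: (iexp_image0 s0); apply: (@iexp_morph _ _ (E \o @psi V N)%FUN _ _ _ _ _ hf').
by move=> x hx; have [i _ <-] := hx; rewrite /= EpsiX; exists (mpsX V i) => //; exists i.
Qed.

Section LaurentComparison.
Variables (p n : nat) (V : idomainType) (R : comNzRingType).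
Variables (M : ideal R) (I : ideal (mps V n)) (phi : {rmorphism quot I -> R}).
Variable pi : {rmorphism mps V n.+1 -> mps V n}.
Hypothesis Vdvr : is_dvr (igen [set p%:R : V]).
Hypothesis Mlocal : is_local M.
Hypothesis charM : has_characteristic (quot M) p.
Hypothesis phi_bij : bijective phi.
Hypothesis piP : is_eval_at_p pi p.

Local Notation S := (mps V n.+1).
Local Notation L := (ipreim pi I).
Local Notation H := (hom_ideal L).

Local Notation theta := (S_to_R phi pi).


Let Vn : noetherian V := dvr_noetherian Vdvr.
Let thetaC v : theta (mpsC V n.+1 v) = V_to_R phi v.
Proof. exact (S_to_R_mpsC phi piP v). Qed.
Let theta0 f : theta f = 0 <-> L f.
Proof. exact (S_to_R_eq0 pi phi_bij f). Qed.

Local Notation A := (homR_laurent I pi).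
Local Notation B := (R_laurent phi).
Local Notation tA := (tensl (Vt_to_homR I pi) (laurent_of_fps V)).
Local Notation cA := (tensr (Vt_to_homR I pi) (laurent_of_fps V)).
Local Notation tB := (tensl (V_to_R phi) (laurentC V)).
Local Notation cB := (tensr (V_to_R phi) (laurentC V)).
Local Notation JA := (homR_laurent_ideal I pi p).
Local Notation JB := (R_laurent_ideal M phi).

Definition laurent_tV : laurent V := qpi (laurent_ideal V) 'X.

Lemma laurent_tV_mul : laurent_tV * laurent_of_fps V fpsX = 1.
Proof.
rewrite mulrC /laurent_of_fps /laurent_tV /= -rmorphM; apply/qpi_eq.
exact: igen_sub.
Qed.

Lemma cB_tV_mul : cB laurent_tV * cB (laurent_of_fps V fpsX) = 1.
Proof. by rewrite -rmorphM laurent_tV_mul rmorph1. Qed.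

Lemma cA_tV_mul : cA (laurent_of_fps V fpsX) * cA laurent_tV = 1.
Proof. by rewrite mulrC -rmorphM laurent_tV_mul rmorph1. Qed.

Lemma R_to_homR_exists : exists lam : {rmorphism R -> homR I pi},
  forall f, lam (theta f) = T_to_homR I pi (psi f).
Proof.
apply: (@rmorph_factor S R (homR I pi) theta (T_to_homR I pi \o @psi V n.+1)%FUN).
  exact: S_to_R_surj phi_bij piP.
by move=> f /theta0 Lf; apply/qpi_eq0; apply: psi_hom_ideal.
Qed.

(** For f in the kernel of theta, psi f lies in the homogenization; thus psi
    induces a morphism from R to hom(R), linear over V. *)
Lemma R_laurent_to_homR_laurent : exists beta : {rmorphism B -> A},
  (forall f, beta (tB (theta f)) = tA (T_to_homR I pi (psi f))) /\
  (forall c, beta (cB c) = cA c).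
Proof.
have [lam lamE] := R_to_homR_exists.
have [|beta [bl br]] := @tensor_lift _ _ _ (V_to_R phi) (laurentC V) A (tA \o lam)%FUN cA.
  move=> v; rewrite -thetaC /= lamE psi_mpsC /laurentC /= -tens_base; congr (tA _).
  by rewrite /Vt_to_homR /= fps_map_C.
by exists beta; split=> // f; rewrite bl /= lamE.
Qed.

Lemma theta_X_JB i : JB (tB (theta (mpsX V i))).
Proof.
apply: igen_sub; exists (theta (mpsX V i)) => //.
apply/(M_presentation Vdvr Mlocal charM phi_bij piP).
by exists (mpsX V i) => //; apply: mpsX_hfil.
Qed.

Lemma JA_X i : JA (tA (T_to_homR I pi (fpsC (mpsX V i)))).
Proof.
by apply: igen_sub; exists (mpsX V i) => //; right; exists i.
Qed.

(** For every k, the evaluation at the elements x_i / t gives an inverse of the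
    morphism induced by psi, modulo the k-th powers of the ideals. *)
Lemma homR_laurent_eval k : exists gam : {rmorphism A -> quot (iexp JB k)},
  [/\ forall f, gam (tA (T_to_homR I pi (psi f))) = qpi (iexp JB k) (tB (theta f)),
      forall c, gam (cA c) = qpi (iexp JB k) (cB c)
    & forall a, iexp JA k a -> gam a = 0].
Proof.
pose q := qpi (iexp JB k).
have [|||E [EC EX Epsi]] := @psi_eval V n.+1 (quot (iexp JB k))
    (q \o tB \o theta)%FUN (q \o cB \o laurent_of_fps V)%FUN (q (cB laurent_tV)) k.
- move=> v; rewrite -[LHS]/(q (tB (theta (mpsC V n.+1 v)))) thetaC.
  by rewrite -[RHS]/(q (cB (laurentC V v))) -tens_base.
- by rewrite /= -rmorphM cB_tV_mul rmorph1.
- move=> f hf; apply/qpi_eq0; apply: (@iexp_morph _ _ (tB \o theta)%FUN _ _ _ _ _ hf).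
  by move=> _ [i _ <-]; apply: theta_X_JB.
have EH u : H u -> E u = 0.
  apply: (@hom_ideal_kernel V n.+1 L _ E (q (cB laurent_tV))).
    by rewrite -(fps_map_X (mpsC V n.+1)) EC /= -rmorphM cB_tV_mul rmorph1.
  by move=> f /theta0 f0; rewrite Epsi -[LHS]/(q (tB (theta f))) f0 !rmorph0.
have [G GE] := quot_lift EH.
have [|gam [gl gr]] := @tensor_lift _ _ _ (Vt_to_homR I pi) (laurent_of_fps V) _ G (q \o cB)%FUN.
  by move=> g; rewrite /Vt_to_homR /= GE EC.
exists gam; split=> [f|c|a ha]; first by rewrite gl GE Epsi.
  by rewrite gr.
apply: (@iexp_image0 _ _ q JB k); first by move=> b /qpi_eq0.
apply: (@iexp_morph _ _ gam _ _ _ _ _ (iexp_igen ha)).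
move=> _ [f [->|[i _ <-]] <-]; rewrite /S_to_homR_laurent gl GE.
  exists (tB p%:R); first by apply: igen_sub; exists p%:R => //; apply: p_in_M charM.
  by rewrite !rmorph_nat.
rewrite EX; exists (cB laurent_tV * tB (theta (mpsX V i))).
  by apply: idealM; apply: theta_X_JB.
by rewrite rmorphM mulrC.
Qed.

(** The morphism beta induced by psi is injective modulo the k-th powers by
    homR_laurent_eval. It is surjective modulo them because its image contains
    V((t)) and the x_i = psi(x_i) / t. *)
Lemma laurent_completions_iso :
  exists F : {rmorphism homR_laurent_completion I pi p -> R_laurent_completion M phi},
    bijective F /\
    (forall c : laurent V,
       F (laurent_to_homR_laurent_completion I pi p c) =
       laurent_to_R_laurent_completion M phi c).
Proof.
have [beta [bl br]] := R_laurent_to_homR_laurent.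
have tX i : beta (tB (theta (mpsX V i))) =
    tA (T_to_homR I pi (fpsC (mpsX V i))) * cA (laurent_of_fps V fpsX).
  rewrite bl psi_mpsX !rmorphM -tens_base; congr (_ * tA _).
  by rewrite /Vt_to_homR /= fps_map_X.
have betaJ b : JB b -> JA (beta b).
  apply: (@igen_min _ _ (ipreim beta JA)) => _ [m + <-] /=.
  move=> /(M_presentation Vdvr Mlocal charM phi_bij piP)[f hf <-].
  have hf' : xideal V n.+1 f.
    have /iexp_xideal := hf; apply: igen_min => y [x Xx [z _ <-]].
    by rewrite mulrC; apply: idealM.
  apply: (@igen_min _ _ (ipreim (beta \o tB \o theta)%FUN JA) _ f hf') => _ [i _ <-].
  rewrite -[ideal_set _ _]/(JA (beta (tB (theta (mpsX V i))))) tX mulrC.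
  by apply: idealM; apply: JA_X.
have approx k h : exists b, iexp JA k (tA (T_to_homR I pi h) - beta b).
  apply: (@fps_mps_dense V n.+1 k
      (fun h => exists b, iexp JA k (tA (T_to_homR I pi h) - beta b))) h
    => [g|i|f g [b hb] [c hc]|f g [b hb] [c hc]|h hh].
  - exists (cB (laurent_of_fps V g)); rewrite br -tens_base subrr; exact: ideal0.
  - exists (tB (theta (mpsX V i)) * cB laurent_tV).
    rewrite rmorphM tX br -mulrA cA_tV_mul mulr1 subrr; exact: ideal0.
  - by exists (b + c); rewrite !rmorphD opprD addrACA; apply: idealD.
  - exists (b * c); rewrite !rmorphM -(subrKA (beta b * tA (T_to_homR I pi g))).
    rewrite -mulrBl -mulrBr; apply: idealD; last exact: idealM.
    by rewrite mulrC; apply: idealM.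
  exists 0; rewrite rmorph0 subr0.
  apply: (@iexp_morph _ _ (tA \o T_to_homR I pi)%FUN _ _ _ _ _ hh) => _ [i _ <-].
  exact: JA_X.
have dense k a : exists b, iexp JA k (a - beta b).
  apply: (@tensor_ind _ _ _ (Vt_to_homR I pi) (laurent_of_fps V)
      (fun a => exists b, iexp JA k (a - beta b))) a
    => [|x y [b hb] [c hc]|u c].
  - by exists 0; rewrite rmorph0 subr0; apply: ideal0.
  - by exists (b + c); rewrite rmorphD opprD addrACA; apply: idealD.
  have [h ->] := qpi_surj u; have [b hb] := approx k h.
  exists (b * cB c); rewrite rmorphM br -mulrBl mulrC; exact: idealM.
have [|//|F [Fbij FE]] := @completion_iso A B JA JB beta.
  move=> k b; split=> [|hb]; last first.
    by apply: (@iexp_morph _ _ beta _ _ _ _ _ hb).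
  have [gam [gl gr gJ]] := homR_laurent_eval k.
  have gb c : gam (beta c) = qpi (iexp JB k) c.
    apply: (@tensor_ind _ _ _ (V_to_R phi) (laurentC V)
      (fun c => gam (beta c) = qpi (iexp JB k) c)) c => [|x y ex ey|a c].
    - by rewrite !rmorph0.
    - by rewrite !rmorphD ex ey.
    have [f <-] := S_to_R_surj phi_bij piP a.
    by rewrite !rmorphM bl br gl gr.
  by move=> /gJ; rewrite gb => /qpi_eq0.
exists F; split=> // c.
by rewrite /laurent_to_homR_laurent_completion -br FE.
Qed.

End LaurentComparison.

Theorem theorem2p12 (p n : nat) (V : idomainType) (R : comNzRingType)
    (M : ideal R) (I : ideal (mps V n)) (phi : {rmorphism quot I -> R})
    (pi : {rmorphism mps V n.+1 -> mps V n}) :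
  is_unramified_cdvr p V ->
  is_noetherian R -> is_local M -> is_complete M ->
  is_mixed_characteristic p M ->
  bijective phi ->
  is_eval_at_p pi p ->
  [/\ forall u : homR I pi, homR_t I pi * u = 0 -> u = 0,
      exists F : {rmorphism homR_mod_t I pi -> gr_completion M},
        bijective F /\
        (forall v : V, F (V_to_homR_mod_t I pi v) = V_to_gr_completion M phi v)
    & exists F : {rmorphism homR_laurent_completion I pi p ->
                    R_laurent_completion M phi},
        bijective F /\
        (forall c : laurent V,
           F (laurent_to_homR_laurent_completion I pi p c) =
           laurent_to_R_laurent_completion M phi c)].
Proof.
move=> [_ _ Vdvr _] _ Mlocal _ [_ charM _ _] phi_bij piP; split.
- by move=> u; apply: homR_t_regular Vdvr _.
- exact: homR_mod_t_iso Vdvr Mlocal charM phi_bij piP.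
- exact: laurent_completions_iso Vdvr Mlocal charM phi_bij piP.
Qed.
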